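(* Let $\Omega\subset\mathbb{R}^2$ be open and bounded with piecewise-smooth boundary $\Gamma$, let $S=\{(x_i,y_i)\}_{i=1}^n$ be nodes, and let $D_x=H^{-1}Q_x$ be a degree $p$ SBP operator for $\partial/\partial x$ on $S$ whose norm matrix $H$ is diagonal. Then the nodes $S$ together with the weights $H_{1,1},\dots,H_{n,n}$ form a cubature rule of degree $2p-1$ on $\Omega$, i.e. $\sum_{j=1}^n H_{j,j}\,f(x_j,y_j)=\int_\Omega f\,d\Omega$ for every polynomial $f$ of total degree at most $2p-1$.
   Context: Monomial basis: for $j\in\{0,\dots,p\}$ and $i\in\{0,\dots,j\}$ set $\mathcal{P}_k(x,y)=x^{i}y^{j-i}$ with $k=j(j+1)/2+i+1$; thus $\mathcal{P}_1,\dots,\mathcal{P}_{\eta_p}$ are the monomials of total degree at most $p$, where $\eta_p=(p+1)(p+2)/2$. For nodes $S$, $\mathbf{p}_k$ is the vector of values of $\mathcal{P}_k$ at the nodes and $\mathbf{p}_k'$ the vector of values of $\partial\mathcal{P}_k/\partial x$ at the nodes. Definition (SBP operator): an $n\times n$ matrix $D_x$ is a degree $p$ SBP approximation of $\partial/\partial x$ on $S$ (for the domain $\Omega$ with boundary $\Gamma$ and outward unit normal $(n_x,n_y)$) if (1) $D_x\mathbf{p}_k=\mathbf{p}_k'$ for all $k\in\{1,\dots,\eta_p\}$; (2) $D_x=H^{-1}Q_x$ with $H$ symmetric positive definite (called the norm matrix); (3) $Q_x=Q_x^A+\tfrac12E_x$ with $(Q_x^A)^T=-Q_x^A$, $E_x^T=E_x$,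 and $\mathbf{p}_k^TE_x\mathbf{p}_m=\oint_\Gamma \mathcal{P}_k\mathcal{P}_m n_x\,d\Gamma$ for all $k,m\in\{1,\dots,\eta_\tau\}$, for some integer $\tau\ge p$. A diagonal-norm SBP operator is one whose $H$ is diagonal. *)

(* Defs.v *)
From HB Require Import structures.
From mathcomp Require Import all_boot all_order all_algebra.
From mathcomp Require Import all_classical all_reals all_analysis.
Set Implicit Arguments. Unset Strict Implicit. Unset Printing Implicit Defensive.
Import Order.TTheory GRing.Theory Num.Theory.
Import numFieldNormedType.Exports.
Local Open Scope classical_set_scope.
Local Open Scope ring_scope.

Section Defs.
Variable R : realType.

(** Monomial basis: P_k(x,y) = x^i y^(j-i), k = j(j+1)/2+i+1, 0<=i<=j<=p.
    We index monomials by the pair (j,i) instead of by k.                  *)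
Definition Pmono (j i : nat) (x y : R) : R := x ^+ i * y ^+ (j - i).
Definition dPmono (j i : nat) (x y : R) : R := i%:R * x ^+ i.-1 * y ^+ (j - i).
Definition in_basis (p j i : nat) : Prop := (i <= j)%N /\ (j <= p)%N.

(** A smooth boundary piece: a C^1 parametrized curve t |-> (cx t, cy t),
    t in [ca, cb]. *)
Record piece := Piece { ca : R; cb : R; cx : R -> R; cy : R -> R }.

Definition C1_piece (c : piece) : Prop :=
  ca c < cb c /\
  (forall t, derivable (cx c) t 1) /\ (forall t, derivable (cy c) t 1) /\
  continuous (derive1 (cx c)) /\ continuous (derive1 (cy c)).

Definition piece_start (c : piece) : R * R := (cx c (ca c), cy c (ca c)).
Definition piece_end (c : piece) : R * R := (cx c (cb c), cy c (cb c)).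

(** Boundary integral  \oint_Gamma g n_x dGamma  over the (oriented) cycle
    Gamma = pieces G_0,...,G_(m-1): on a positively oriented curve,
    n_x dGamma = dy. *)
Definition bdry_int_nx (m : nat) (G : 'I_m -> piece) (g : R -> R -> R) : R :=
  \sum_(l < m) \int[lebesgue_measure]_(t in `[ca (G l), cb (G l)])
                 (g (cx (G l) t) (cy (G l) t) * derive1 (cy (G l)) t).

Definition winding (m : nat) (G : 'I_m -> piece) (z0 : R * R) : R :=
  (2 * pi)^-1 * \sum_(l < m) \int[lebesgue_measure]_(t in `[ca (G l), cb (G l)])
     (((cx (G l) t - z0.1) * derive1 (cy (G l)) t
        - (cy (G l) t - z0.2) * derive1 (cx (G l)) t)
      / ((cx (G l) t - z0.1) ^+ 2 + (cy (G l) t - z0.2) ^+ 2)).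

Definition on_cycle (m : nat) (G : 'I_m -> piece) (z : R * R) : Prop :=
  exists l : 'I_m, exists2 t, ca (G l) <= t <= cb (G l) &
    z = (cx (G l) t, cy (G l) t).

(** Omega is an open bounded subset of R^2 whose boundary Gamma is
    piecewise smooth, given by the closed positively-oriented cycle of C^1
    pieces G (Omega lies on its left: winding number 1 inside, 0 outside),
    so that the outward normal satisfies n_x dGamma = dy along G. *)
Definition ps_domain (Om : set (R * R)) (m : nat) (G : 'I_m -> piece) : Prop :=
  [/\ open Om /\
      (exists M : R, forall z, Om z -> `|z.1| <= M /\ `|z.2| <= M),
      (forall l, C1_piece (G l)),
      perm_eq [seq piece_start (G l) | l <- enum 'I_m]
              [seq piece_end (G l) | l <- enum 'I_m],
      closure Om `\` Om = on_cycle G &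
      (forall z, ~ on_cycle G z -> winding G z = if `[< Om z >] then 1 else 0)].

Definition nodal (n : nat) (sx sy : 'I_n -> R) (f : R -> R -> R) : 'cV[R]_n :=
  \col_(a < n) f (sx a) (sy a).

Definition SBP_x (Om : set (R * R)) (m : nat) (G : 'I_m -> piece)
    (n : nat) (sx sy : 'I_n -> R) (p : nat) (D H : 'M[R]_n) : Prop :=
  [/\
      (forall j i, in_basis p j i ->
         D *m nodal sx sy (Pmono j i) = nodal sx sy (dPmono j i)),
      H^T = H,
      (forall v : 'cV[R]_n, v != 0 -> 0 < (v^T *m H *m v) 0 0) &
      exists Q : 'M[R]_n,
        D = invmx H *m Q /\
        exists (QA E : 'M[R]_n) (tau : nat),
          [/\ (p <= tau)%N, Q = QA + 2^-1 *: E, QA^T = - QA, E^T = E &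
              forall j i j' i', in_basis tau j i -> in_basis tau j' i' ->
                (nodal sx sy (Pmono j i))^T *m E *m nodal sx sy (Pmono j' i')
                = (bdry_int_nx G (fun x y => Pmono j i x y * Pmono j' i' x y))%:M]].

Definition poly2 (d : nat) (c : nat -> nat -> R) (x y : R) : R :=
  \sum_(a < d) \sum_(b < d | (a + b < d)%N) c a b * x ^+ a * y ^+ b.

Definition is_diag (n : nat) (H : 'M[R]_n) : Prop :=
  forall a b : 'I_n, a != b -> H a b = 0.

End Defs.

Notation area_meas R := ((@lebesgue_measure R) \x (@lebesgue_measure R))%E.

(* Main.v *)
(** The discrete part is summation by parts: for monomials P, P' of degree at
    most p, the SBP axioms give
      sum_j H_jj (P P')_x(x_j, y_j) = P^T E P' = oint P P' n_x,
    and every monomial of degree at most 2p-1 is, up to a factor, of the form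
    (P P')_x.  What remains is Green's formula on Omega,
      oint F(x) g(y) dy = int_Omega f(x) g(y),  F' = f,
    for a domain described by its winding number w.

    Since w = 1_Omega almost everywhere, Fubini on the box B = [-L, L]^2 gives
      2 pi int_Omega f g = oint A dy - A' dx,
    where A(x, y) is the integral over B of f(s) g(t) u / (u^2 + v^2), with
    u = x - s and v = y - t, and A' is obtained by exchanging the coordinates
    ([kerpot]).  The function T(x, y) = int_B f(s) g(t) atan(v/u) ([atanpot]) has
    dT/dy = A, and atan(v/u) + atan(u/v) = (pi/2) sgn(u) sgn(v) expresses dT/dx
    through A' and the elementary integrals of f(s) sgn(x - s).  Hence
    A dy - A' dx - 2 pi F(x) g(y) dy is an exact form, whose integral over the
    cycle vanishes.  Singular integrals are harmless because the integral of
    |u| / (u^2 + v^2) in v is at most pi, for every u. *)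

Require Import Defs.
From HB Require Import structures.
From mathcomp Require Import all_boot all_order all_algebra.
From mathcomp Require Import all_classical all_reals all_analysis.
From mathcomp Require Import measurable_realfun.
From mathcomp Require Import ring lra zify.
Set Implicit Arguments.
Unset Strict Implicit.
Unset Printing Implicit Defensive.
Import Order.TTheory GRing.Theory Num.Theory.
Import numFieldNormedType.Exports.
Local Open Scope classical_set_scope.
Local Open Scope ring_scope.

(** * Products of measures and integrals *)

Section sigma_finite_product.
Context d1 d2 (T1 : measurableType d1) (T2 : measurableType d2) (R : realType).
Variables (m1 : {sigma_finite_measure set T1 -> \bar R})
  (m2 : {sigma_finite_measure set T2 -> \bar R}).

(* [product_measure1] has a sigma-finite structure only when [m1] and [m2] are
   subprobabilities, hence this alias. *)
Definition sfprod : set (T1 * T2) -> \bar R := (m1 \x m2)%E.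

HB.instance Definition _ := Measure.on sfprod.

Let sfprod_sigma_finite : sigma_finite setT sfprod.
Proof.
have /sigma_finiteP[F [TF ndF Foo]] := sigma_finiteT m1.
have /sigma_finiteP[G [TG ndG Goo]] := sigma_finiteT m2.
exists (fun n => F n `*` G n).
  rewrite -setXTT TF TG; apply/seteqP; split.
    move=> [x y] [/= [n _ Fnx] [k _ Gky]]; exists (maxn n k) => //; split => /=.
      by move: x Fnx; apply/subsetPset/ndF/leq_maxl.
    by move: y Gky; apply/subsetPset/ndG/leq_maxr.
  by move=> z [n _ []/= ? ?]; split; exists n.
move=> k; have [mF Fk] := Foo k; have [mG Gk] := Goo k.
split; first exact: measurableX.
by rewrite /sfprod product_measure1E // lte_mul_pinfty // ge0_fin_numE.
Qed.

HB.instance Definition _ :=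
  Measure_isSigmaFinite.Build _ _ _ sfprod sfprod_sigma_finite.

End sigma_finite_product.

Lemma measurable_funV (R : realType) : measurable_fun setT (@GRing.inv R).
Proof.
have -> : @GRing.inv R = (fun x => if x == 0 then 0 else x^-1).
  by apply/funext => x; case: eqP => // ->; rewrite invr0.
apply: measurable_fun_if => //.
- exact: measurable_fun_eqr.
- have -> : [set: R] `&` (fun x : R => x == 0) @^-1` [set false] = [set x | x != 0].
    by apply/seteqP; split => x /=; [case=> _ ->|move=> /negbTE ->].
  apply: open_continuous_measurable_fun; first exact: open_neq.
  by move=> x; rewrite inE /= => x0; exact: inv_continuous.
Qed.

(** * Real-valued integrals: finiteness and dominated convergence *)

Section Rintegral_tools.
Context d (T : measurableType d) (R : realType) (mu : {measure set T -> \bar R}).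

(** An integrable function is finite almost everywhere, so [fine] alters it only on a null set. This
    is the passage from extended-valued inner integrals to real ones in Fubini's theorem. *)
Lemma integrable_fine (D : set T) (g : T -> \bar R) : measurable D ->
  mu.-integrable D g ->
  mu.-integrable D (EFin \o (fine \o g)) /\
  \int[mu]_(x in D) fine (g x) = fine (\int[mu]_(x in D) g x)%E.
Proof.
move=> mD ig; have mg := measurable_int mu ig.
have mf : measurable_fun D (EFin \o (fine \o g)).
  by apply/measurable_EFinP; exact: measurableT_comp.
have ae : ae_eq mu D g (EFin \o (fine \o g)).
  apply: filterS (integrable_ae mD ig) => x fx Dx /=.
  by rewrite fineK // fx.
split.
  apply/integrableP; split=> //.
  have /integrableP[_] := ig.
  congr (_ < _)%E; apply: ae_eq_integral => //.
  - exact: measurableT_comp.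
  - exact: measurableT_comp.
  - by apply: filterS ae => x h Dx; rewrite /= (h Dx).
by rewrite /Rintegral; congr fine; apply: esym; exact: ae_eq_integral.
Qed.

Lemma Rintegral_cvg (D : set T) (f_ : (T -> R)^nat) (f : T -> R) (C : R) :
  measurable D -> (mu D < +oo)%E ->
  (forall n, measurable_fun D (f_ n)) -> measurable_fun D f ->
  {ae mu, forall x, D x -> f_ n x @[n --> \oo] --> f x} ->
  (forall n x, D x -> `|f_ n x| <= C) ->
  \int[mu]_(x in D) f_ n x @[n --> \oo] --> \int[mu]_(x in D) f x.
Proof.
move=> mD fD mf_ mf cf bf.
have iC : mu.-integrable D (EFin \o cst C).
  apply: measurable_bounded_integrable => //.
  by exists `|C|; split => // M CM x _ /=; exact: ltW.
have mf_' n : measurable_fun D (EFin \o f_ n) by exact/measurable_EFinP.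
have mf' : measurable_fun D (EFin \o f) by exact/measurable_EFinP.
have [||i1 _ i2] := @dominated_convergence _ _ _ mu D mD
  (fun n => EFin \o f_ n) (EFin \o f) _ mf_' mf' _ iC.
- by apply: filterS cf => x h Dx; apply: cvg_EFin; [exact: nearW|exact: h].
- by apply: aeW => x n Dx; rewrite lee_fin bf.
have iF n : mu.-integrable D (EFin \o f_ n).
  apply: le_integrable iC => // x Dx /=; rewrite lee_fin.
  by rewrite (le_trans (bf n x Dx)) // ler_norm.
apply: fine_cvg; rewrite /Rintegral fineK //.
exact: integrable_fin_num.
Qed.

End Rintegral_tools.

(** * Fubini and Tonelli on rectangles *)

Section Rfubini.
Context d1 d2 (T1 : measurableType d1) (T2 : measurableType d2) (R : realType).
Variables (m1 : {sigma_finite_measure set T1 -> \bar R})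
  (m2 : {sigma_finite_measure set T2 -> \bar R}).
Variables (D1 : set T1) (D2 : set T2).
Hypotheses (mD1 : measurable D1) (mD2 : measurable D2).

(** The product theorems are applied on the whole space to the extension by zero; each of its
    sections is zero or again an extension by zero. *)
Lemma restrict_setX1 (h : T1 * T2 -> \bar R) x :
  (fun y => (h \_ (D1 `*` D2)) (x, y)) =
  if x \in D1 then (fun y => h (x, y)) \_ D2 else cst 0%E.
Proof.
apply/funext => y; rewrite patchE in_setX /=.
by case: (x \in D1) => //=; rewrite patchE.
Qed.

Lemma restrict_setX2 (h : T1 * T2 -> \bar R) y :
  (fun x => (h \_ (D1 `*` D2)) (x, y)) =
  if y \in D2 then (fun x => h (x, y)) \_ D1 else cst 0%E.
Proof.
apply/funext => x; rewrite patchE in_setX /= andbC.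
by case: (y \in D2) => //=; rewrite patchE.
Qed.

Lemma fubini_F_restrict (h : T1 * T2 -> \bar R) :
  fubini_F m2 (h \_ (D1 `*` D2)) =
  (fun x => \int[m2]_(y in D2) h (x, y))%E \_ D1.
Proof.
apply/funext => x; rewrite /fubini_F restrict_setX1 patchE.
by case: ifP => _; [rewrite -integral_mkcond|rewrite integral0].
Qed.

Lemma fubini_G_restrict (h : T1 * T2 -> \bar R) :
  fubini_G m1 (h \_ (D1 `*` D2)) =
  (fun y => \int[m1]_(x in D1) h (x, y))%E \_ D2.
Proof.
apply/funext => x; rewrite /fubini_G restrict_setX2 patchE.
by case: ifP => _; [rewrite -integral_mkcond|rewrite integral0].
Qed.

Section integrable.
Variable f : T1 * T2 -> R.
Hypothesis ifD : (m1 \x m2)%E.-integrable (D1 `*` D2) (EFin \o f).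

Let mD12 : measurable (D1 `*` D2). Proof. exact: measurableX. Qed.

Let ifT : (m1 \x m2)%E.-integrable setT ((EFin \o f) \_ (D1 `*` D2)).
Proof. by apply/(integrable_mkcond _ mD12). Qed.

Let i1 : m1.-integrable D1 (fun x => \int[m2]_(y in D2) (f (x, y))%:E)%E.
Proof.
apply/integrable_mkcond => //.
by have := integrable_fubini_F ifT; rewrite fubini_F_restrict.
Qed.

Let i2 : m2.-integrable D2 (fun y => \int[m1]_(x in D1) (f (x, y))%:E)%E.
Proof.
apply/integrable_mkcond => //.
suff: m2.-integrable setT (fubini_G m1 ((EFin \o f) \_ (D1 `*` D2))).
  by rewrite fubini_G_restrict.
have mf := measurable_int _ ifT.
apply/integrableP; split; first exact: measurable_fubini_G ifT.
(* The iterated integral of the absolute value in the exchanged order is finite by Tonelli, and it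
   dominates. *)
apply: le_lt_trans ((integrable21ltyP _ _ mf).1 ifT).
apply: ge0_le_integral => //.
- by apply: measurableT_comp => //; exact: measurable_fubini_G ifT.
- apply: (measurable_fun_fubini_tonelli_G (abse \o ((EFin \o f) \_ (D1 `*` D2)))) => //=.
  exact: measurableT_comp.
- move=> y _; apply: le_abse_integral => //.
  exact: measurable_fun_pair1 mf.
Qed.

Lemma integrable_Rfubini1 :
  m1.-integrable D1 (fun x => (\int[m2]_(y in D2) f (x, y))%:E).
Proof. by have [] := integrable_fine mD1 i1. Qed.

Lemma integrable_Rfubini2 :
  m2.-integrable D2 (fun y => (\int[m1]_(x in D1) f (x, y))%:E).
Proof. by have [] := integrable_fine mD2 i2. Qed.

Lemma Rfubini1 : \int[m1]_(x in D1) \int[m2]_(y in D2) f (x, y) =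
  \int[(m1 \x m2)%E]_(z in D1 `*` D2) f z.
Proof.
have [_ ->] := integrable_fine mD1 i1.
rewrite /Rintegral [in RHS]integral_mkcond -(integral12_prod_meas1 ifT).
by rewrite fubini_F_restrict -integral_mkcond.
Qed.

Lemma Rfubini2 : \int[m2]_(y in D2) \int[m1]_(x in D1) f (x, y) =
  \int[(m1 \x m2)%E]_(z in D1 `*` D2) f z.
Proof.
have [_ ->] := integrable_fine mD2 i2.
rewrite /Rintegral [in RHS]integral_mkcond -(integral21_prod_meas1 ifT).
by rewrite fubini_G_restrict -integral_mkcond.
Qed.

End integrable.

Let mD12 : measurable (D1 `*` D2). Proof. exact: measurableX. Qed.

Let restrict_measurable (h : T1 * T2 -> \bar R) :
  measurable_fun setT h -> measurable_fun setT (h \_ (D1 `*` D2)).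
Proof. by move=> mh; apply/(measurable_restrictT _ mD12); exact: measurable_funTS. Qed.

Let restrict_ge0 (h : T1 * T2 -> \bar R) : (forall z, 0 <= h z)%E ->
  forall z, (0 <= (h \_ (D1 `*` D2)) z)%E.
Proof. by move=> h0 z; rewrite patchE; case: ifP. Qed.

(** Tonelli in the form suited to kernels that are unbounded on the rectangle while the integrals of
    their sections stay bounded. *)
Lemma integral_setX1_le (h : T1 * T2 -> \bar R) (C : R) :
  measurable_fun setT h -> (forall z, 0 <= h z)%E -> 0 <= C ->
  (forall x, D1 x -> \int[m2]_(y in D2) h (x, y) <= C%:E)%E ->
  (\int[m1 \x m2]_(z in D1 `*` D2) h z <= C%:E * m1 D1)%E.
Proof.
move=> mh h0 C0 hC.
rewrite integral_mkcond fubini_tonelli1; [|exact: restrict_measurable|exact: restrict_ge0].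
rewrite fubini_F_restrict -integral_mkcond -(integral_cst _ mD1).
apply: ge0_le_integral => //.
- by move=> x Dx; exact: integral_ge0.
- apply/(measurable_restrictT _ mD1); rewrite -fubini_F_restrict.
  by apply: measurable_fun_fubini_tonelli_F; [exact: restrict_measurable|exact: restrict_ge0].
Qed.

Lemma integral_setX2_le (h : T1 * T2 -> \bar R) (C : R) :
  measurable_fun setT h -> (forall z, 0 <= h z)%E -> 0 <= C ->
  (forall y, D2 y -> \int[m1]_(x in D1) h (x, y) <= C%:E)%E ->
  (\int[m1 \x m2]_(z in D1 `*` D2) h z <= C%:E * m2 D2)%E.
Proof.
move=> mh h0 C0 hC.
rewrite integral_mkcond fubini_tonelli2; [|exact: restrict_measurable|exact: restrict_ge0].
rewrite fubini_G_restrict -integral_mkcond -(integral_cst _ mD2).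
apply: ge0_le_integral => //.
- by move=> x Dx; exact: integral_ge0.
- apply/(measurable_restrictT _ mD2); rewrite -fubini_G_restrict.
  by apply: measurable_fun_fubini_tonelli_G; [exact: restrict_measurable|exact: restrict_ge0].
Qed.

Section integrable_setX.
Variables (f : T1 * T2 -> R) (C : R).
Hypotheses (mf : measurable_fun setT f) (C0 : 0 <= C).

Let mabs : measurable_fun setT (fun z => `|f z|%:E).
Proof. by apply/measurable_EFinP; exact: measurableT_comp. Qed.

Lemma integrable_setX1 : (m1 D1 < +oo)%E ->
  (forall x, D1 x -> \int[m2]_(y in D2) `|f (x, y)|%:E <= C%:E)%E ->
  (m1 \x m2)%E.-integrable (D1 `*` D2) (EFin \o f).
Proof.
move=> fD1 fC; apply/integrableP; split.
  by apply/measurable_EFinP; exact: measurable_funTS.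
apply: (le_lt_trans (integral_setX1_le mabs _ C0 fC)) => //.
by rewrite lte_mul_pinfty.
Qed.

End integrable_setX.

End Rfubini.

(** * Measurability and null sets in the plane *)

Section plane.
Context {R : realType}.
Let mu := @lebesgue_measure R.

(** The sigma-algebra on the plane is the product one, so [A] is exhibited as a countable union of
    boxes with rational corners, a box not contained in [A] being replaced by the empty set. *)
Lemma open_measurable_plane (A : set (R * R)) : open A -> measurable A.
Proof.
move=> oA.
pose box (q : rat * rat * (rat * rat)) : set (R * R) :=
  `]ratr q.1.1, ratr q.1.2[ `*` `]ratr q.2.1, ratr q.2.2[.
have -> : A = \bigcup_q (if `[< box q `<=` A >] then box q else set0).
  apply/seteqP; split => [[x y] Axy|z [q _]]; last first.
    by case: ifPn => // /asboolP; apply.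
  have /nbhs_ballP[e /= e0 xyA] : nbhs (x, y) A by exact: open_nbhs_nbhs.
  have [q1 q1P] : exists q, ratr q \in `](x - e), x[ by apply: rat_in_itvoo; lra.
  have [q2 q2P] : exists q, ratr q \in `]x, (x + e)[ by apply: rat_in_itvoo; lra.
  have [q3 q3P] : exists q, ratr q \in `](y - e), y[ by apply: rat_in_itvoo; lra.
  have [q4 q4P] : exists q, ratr q \in `]y, (y + e)[ by apply: rat_in_itvoo; lra.
  exists (q1, q2, (q3, q4)) => //.
  move: q1P q2P q3P q4P; rewrite !in_itv /= => /andP[? ?] /andP[? ?] /andP[? ?] /andP[? ?].
  rewrite ifT /box /=; first by split; rewrite /= in_itv /=; apply/andP; split.
  apply/asboolP => -[u v] [/= ]; rewrite !in_itv /= => /andP[? ?] /andP[? ?].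
  by apply: xyA; split; rewrite /ball /= ltr_norml; apply/andP; split; lra.
apply: countable_bigcupT_measurable; first exact: countableP.
move=> q; case: ifP => // _.
by apply: measurableX; exact: measurable_itv.
Qed.

(** Cutting [[a, b]] into steps of length [h n] covers the curve by boxes of side [2 * C * h n].
    Their number grows like [n] and the area of each decays like [1 / n ^ 2], so the total area
    tends to 0. *)
Lemma negligible_lipschitz_curve (x y : R -> R) (a b C : R) : a < b -> 0 < C ->
  (forall s t, a <= s <= b -> a <= t <= b -> `|x s - x t| <= C * `|s - t|) ->
  (forall s t, a <= s <= b -> a <= t <= b -> `|y s - y t| <= C * `|s - t|) ->
  (mu \x mu)%E.-negligible [set z | exists2 t, a <= t <= b & z = (x t, y t)].
Proof.
move=> ab C0 lx ly.
pose h n : R := (b - a) / n.+1%:R.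
have h0 n : 0 < h n by rewrite divr_gt0 ?subr_gt0.
pose t n i : R := a + i%:R * h n.
pose box n i : set (R * R) :=
  `[x (t n i) - C * h n, x (t n i) + C * h n]
  `*` `[y (t n i) - C * h n, y (t n i) + C * h n].
have mbox n i : measurable (box n i) by apply: measurableX; exact: measurable_itv.
(* The last index [n.+1] is there for the endpoint [b]. *)
pose U n := \big[setU/set0]_(i < n.+2) box n i.
have mU n : measurable (U n) by apply: bigsetU_measurable.
have mbox_le n i : (mu \x mu)%E (box n i) = ((2 * C * h n) ^+ 2)%:E.
  rewrite product_measure1E //= !lebesgue_measure_itv /= !lte_fin.
  have Ch : 0 < C * h n by rewrite mulr_gt0.
  rewrite !ifT; [|lra|lra].
  by rewrite -!EFinD -EFinM; congr EFin; ring.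
have mU_le n : ((mu \x mu)%E (U n) <= (8 * C ^+ 2 * (b - a) ^+ 2 / n.+1%:R)%:E)%E.
  apply: le_trans; first by apply: Boole_inequality => i _; exact: mbox.
  rewrite (eq_bigr (fun=> ((2 * C * h n) ^+ 2)%:E)); last by move=> i _; exact: mbox_le.
  rewrite sumEFin lee_fin sumr_const card_ord -[leLHS]mulr_natl /h.
  have -> : n.+2%:R * (2 * C * ((b - a) / n.+1%:R)) ^+ 2 =
    n.+2%:R * ((4 * C ^+ 2 * (b - a) ^+ 2) / n.+1%:R ^+ 2) :> R by field.
  have -> : 8 * C ^+ 2 * (b - a) ^+ 2 / n.+1%:R =
    (2 * n.+1%:R) * ((4 * C ^+ 2 * (b - a) ^+ 2) / n.+1%:R ^+ 2) :> R.
    by field.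
  apply: ler_wpM2r.
    by rewrite mulr_ge0 ?invr_ge0 ?exprn_ge0 // !mulr_ge0 ?exprn_ge0 // ?subr_ge0 ltW.
  by rewrite -natrM ler_nat mul2n -addnn addSn !ltnS leq_addl.
exists (\bigcap_n U n); split; first exact: bigcapT_measurable.
  apply/eqP; rewrite eq_le measure_ge0 andbT.
  apply/lee_addgt0Pr => e e0; rewrite add0e.
  (* Large enough for the area bound of [U n] to be at most [e]. *)
  pose n := Num.trunc (8 * C ^+ 2 * (b - a) ^+ 2 / e).
  apply: (@le_trans _ _ ((mu \x mu)%E (U n))).
    apply: le_measure; rewrite ?inE.
    - by apply: bigcapT_measurable => k; exact: mU.
    - exact: mU.
    - exact: bigcap_inf.
  apply: (le_trans (mU_le n)); rewrite lee_fin ler_pdivrMr // [leRHS]mulrC -ler_pdivrMr //.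
  suff /truncn_itv/andP[_ /ltW] : 0 <= 8 * C ^+ 2 * (b - a) ^+ 2 / e by [].
  by rewrite divr_ge0 ?(ltW e0) // !mulr_ge0 ?exprn_ge0 // ?subr_ge0 ltW.
move=> _ [s /andP[as_ sb] ->] n _.
pose i := Num.trunc ((s - a) / h n).
have /andP[i1 i2] : i%:R <= (s - a) / h n < i.+1%:R.
  by apply: truncn_itv; rewrite divr_ge0 ?subr_ge0 // ltW.
move: i1 i2; rewrite ler_pdivlMr // ltr_pdivrMr // => i1 i2.
have iN : (i < n.+2)%N.
  rewrite ltnS -(ler_nat R) -(ler_pM2r (h0 n)) (le_trans i1) //.
  by rewrite /h mulrC divfK ?lerB.
rewrite /U (bigD1 (Ordinal iN)) //=; left.
have hn : n.+1%:R * h n = b - a by rewrite /h mulrC divfK.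
have i3 : i%:R * h n <= b - a by rewrite (le_trans i1) // lerB.
have ih0 : 0 <= i%:R * h n by rewrite mulr_ge0 ?ler0n ?ltW.
move: i2; rewrite -natr1 mulrDl mul1r => i2.
have tn : a <= t n i <= b by rewrite /t; apply/andP; split; lra.
have sab : a <= s <= b by rewrite as_.
have st : `|s - t n i| <= h n by rewrite ler_norml /t; apply/andP; split; lra.
have := lx s (t n i) sab tn; have := ly s (t n i) sab tn.
have Cst : C * `|s - t n i| <= C * h n by rewrite ler_pM2l.
move=> /le_trans /(_ Cst); rewrite ler_norml => /andP[? ?].
move=> /le_trans /(_ Cst); rewrite ler_norml => /andP[? ?].
by split; rewrite /= in_itv /=; apply/andP; split; lra.
Qed.

End plane.

(** * The angular kernel *)

Section kernel.
Context {R : realType}.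
Let mu := @lebesgue_measure R.

Lemma is_derive_continuous (F : R -> R) (t l : R) :
  is_derive t 1 F l -> {for t, continuous F}.
Proof.
by move=> ?; apply/differentiable_continuous/derivable1_diffP; exact: ex_derive.
Qed.

Lemma FTC2_is_derive (F f : R -> R) (a b : R) : a < b ->
  (forall t, a <= t <= b -> is_derive t 1 F (f t)) ->
  {within `[a, b], continuous f} ->
  (\int[mu]_(t in `[a, b]) (f t)%:E = (F b - F a)%:E)%E.
Proof.
move=> ab dF cf; have cF t : a <= t <= b -> {for t, continuous F}.
  by move=> /dF; exact: is_derive_continuous.
rewrite (@continuous_FTC2 _ _ F) // ?EFinB //.
  split.
  - move=> t /[!in_itv] /= /andP[? ?].
    by have tab : a <= t <= b; [lra|have := dF t tab => ?; exact: ex_derive].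
  - by apply/cvg_at_right_filter/cF; lra.
  - by apply/cvg_at_left_filter/cF; lra.
move=> t /[!in_itv] /= /andP[? ?]; rewrite derive1E.
by have tab : a <= t <= b; [lra|have := dF t tab => ?; exact: derive_val].
Qed.

Lemma continuous_integrable_itv (f : R -> R) (a b : R) :
  {within `[a, b], continuous f} -> mu.-integrable `[a, b] (EFin \o f).
Proof. by move=> cf; apply: continuous_compact_integrable => //; exact: segment_compact. Qed.

(** This is the derivative of [atan (v / u)] in [v]. Division by zero being 0, both functions vanish
    for [u = 0], so the relation holds for all [u] and [v]. *)
Definition ker (u v : R) : R := u / (u ^+ 2 + v ^+ 2).

Lemma measurable_ker d (T : measurableType d) (a b : T -> R) :
  measurable_fun setT a -> measurable_fun setT b ->
  measurable_fun setT (fun t => ker (a t) (b t)).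
Proof.
move=> ma mb; apply: measurable_funM => //.
apply: (measurableT_comp (@measurable_funV R)).
by apply: measurable_funD; exact: measurable_funX.
Qed.

Lemma measurable_atan_div d (T : measurableType d) (a b : T -> R) :
  measurable_fun setT a -> measurable_fun setT b ->
  measurable_fun setT (fun t => atan (b t / a t)).
Proof.
move=> ma mb; apply: measurableT_comp.
  by apply: continuous_measurable_fun => t; exact: continuous_atan.
by apply: measurable_funM => //; exact: (measurableT_comp (@measurable_funV R)).
Qed.

Lemma ker0 (v : R) : ker 0 v = 0. Proof. by rewrite /ker mul0r. Qed.

Lemma sqr2D_neq0 (u v : R) : u != 0 -> u ^+ 2 + v ^+ 2 != 0.
Proof. by move=> u0; rewrite paddr_eq0 ?sqr_ge0 // sqrf_eq0 (negbTE u0). Qed.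

Lemma ker_le (u v : R) : `|ker u v| <= `|u|^-1.
Proof.
have [->|u0] := eqVneq u 0; first by rewrite ker0 normr0 invr0.
have n0 : 0 < `|u| by rewrite normr_gt0.
rewrite /ker normrM normfV -ler_pdivlMl // (ger0_norm (addr_ge0 (sqr_ge0 _) (sqr_ge0 _))).
rewrite -invfM lef_pV2 ?posrE ?mulr_gt0 //; last first.
  by rewrite lt0r sqr2D_neq0 // addr_ge0 // sqr_ge0.
by rewrite -normrM -expr2 ger0_norm ?sqr_ge0 // lerDl sqr_ge0.
Qed.

Lemma is_derive_atan_div (u v : R) : is_derive v 1 (fun v => atan (v / u)) (ker u v).
Proof.
have [->|u0] := eqVneq u 0.
  rewrite ker0 (_ : (fun v => _) = cst 0); first exact: is_derive_cst.
  by apply/funext => w; rewrite invr0 mulr0 atan0.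
have d1 : is_derive v 1 (fun v : R => v / u) u^-1.
  have := @is_deriveM _ _ id (cst u^-1) v 1 1 0 (is_derive_id _ _) (is_derive_cst _ _ _).
  by rewrite scaler0 add0r /GRing.scale /= mulr1.
have := @is_derive1_comp _ atan (fun v => v / u) v _ _ (is_derive1_atan _) d1.
rewrite /comp; congr (is_derive _ _ _ _).
by rewrite /ker; field; rewrite u0 sqr2D_neq0.
Qed.

Lemma ker_cvg (T : Type) (F : set_system T) (FF : Filter F) (a b : T -> R) (u v : R) :
  u != 0 -> a @ F --> u -> b @ F --> v -> ker (a t) (b t) @[t --> F] --> ker u v.
Proof.
move=> u0 au bv; apply: cvgM => //; apply: cvgV; first exact: sqr2D_neq0.
by apply: cvgD; rewrite expr2; under eq_fun do rewrite expr2; exact: cvgM.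
Qed.

Lemma ker_continuous (u y : R) : continuous (fun t => ker u (y - t)).
Proof.
move=> t; have [->|u0] := eqVneq u 0.
  by under eq_fun do rewrite ker0; exact: cst_continuous.
by apply: ker_cvg => //; [exact: cvg_cst|apply: cvgB; [exact: cvg_cst|exact: cvg_id]].
Qed.

Lemma atanB_le (s t : R) : `|atan s - atan t| <= pi.
Proof.
have := atan_gtNpi2 s; have := atan_ltpi2 s; have := atan_gtNpi2 t; have := atan_ltpi2 t.
by rewrite ler_norml => *; apply/andP; split; lra.
Qed.

(** [|ker u v|] equals [ker |u| v], whose primitive in [t] is an arctangent, and two values of
    [atan] differ by at most [pi]. The bound does not depend on [u], which is what tames the
    singularity later. *)
Lemma integral_ker_le (u y a b : R) : a < b ->
  (\int[mu]_(t in `[a, b]) `|ker u (y - t)|%:E <= pi%:E)%E.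
Proof.
move=> ab.
have -> : (fun t => `|ker u (y - t)|%:E) = (fun t => (ker `|u| (y - t))%:E).
  apply/funext => t; rewrite /ker normrM normfV real_normK ?num_real //.
  by rewrite [X in _ / X]ger0_norm // addr_ge0 ?sqr_ge0.
have dF t : a <= t <= b ->
    is_derive t 1 (fun t => - atan ((y - t) / `|u|)) (ker `|u| (y - t)).
  move=> _; have d1 : is_derive t 1 (fun t : R => y - t) (- 1).
    by have := is_deriveB (is_derive_cst y t 1) (is_derive_id t (1 : R)); rewrite sub0r.
  have := is_deriveN (@is_derive1_comp _ (fun v => atan (v / `|u|)) (fun t => y - t) t _ _
    (is_derive_atan_div `|u| (y - t)) d1).
  by rewrite mulrN1 opprK.
rewrite (FTC2_is_derive ab dF); last first.
  by apply: continuous_subspaceT => t; exact: ker_continuous.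
by rewrite lee_fin (le_trans (ler_norm _)) // opprK addrC atanB_le.
Qed.

End kernel.

(** * Differentiation under the integral sign and along a curve *)

Section calculus.
Context {R : realType}.
Let mu := @lebesgue_measure R.

Lemma continuous_itv_bound (f : R -> R) (a b : R) :
  {within `[a, b], continuous f} ->
  exists2 M, 0 <= M & forall t, a <= t <= b -> `|f t| <= M.
Proof.
move=> cf; have := continuous_compact cf (@segment_compact _ a b).
move=> /compact_bounded [N [_ NP]].
exists (`|N| + 1); first by rewrite addr_ge0.
move=> t tab; apply: (NP (`|N| + 1)).
  by rewrite (le_lt_trans (ler_norm _)) // ltrDl.
by exists t => //=; rewrite in_itv.
Qed.

Lemma is_derive_Rintegral d (Y : measurableType d) (nu : {measure set Y -> \bar R})
    (D : set Y) (F F' : R -> Y -> R) (C a : R) : 0 <= C ->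
  measurable D -> (nu D < +oo)%E ->
  (forall x, nu.-integrable D (EFin \o F x)) ->
  (forall (x : R) y, D y -> is_derive x 1 (F^~ y) (F' x y)) ->
  (forall x y, D y -> `|F' x y| <= C) ->
  is_derive a 1 (fun x => \int[nu]_(y in D) F x y) (\int[nu]_(y in D) F' a y).
Proof.
move=> C0 mD fD iF dF bF'.
have d1E x y : D y -> partial1of2 F x y = F' x y.
  by move=> /(dF x) ?; rewrite partial1of2E; exact: derive_val.
have Ia : `]a - 1, a + 1[%classic a by rewrite /= in_itv /=; apply/andP; split; lra.
have dr x y : `]a - 1, a + 1[%classic x -> D y -> derivable (F^~ y) x 1.
  by move=> _ /(dF x) ?; exact: ex_derive.
have iC : nu.-integrable D (EFin \o cst C).
  apply: measurable_bounded_integrable => //.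
  by exists `|C|; split => // M CM x _ /=; exact: ltW.
have ub x y : `]a - 1, a + 1[%classic x -> D y -> `|partial1of2 F x y| <= cst C y.
  by move=> _ Dy; rewrite d1E // bF'.
apply: DeriveDef.
  exact: (@derivable_under_integral _ _ _ nu F D mD a _ _ Ia (fun x _ => iF x) dr (cst C)).
rewrite -derive1E.
rewrite (@differentiation_under_integral _ _ _ nu F D mD a _ _ Ia (fun x _ => iF x) dr (cst C)) //.
by apply: eq_Rintegral => y /[!inE]; exact: d1E.
Qed.

(** Reduces a limit at a point of the plane to limits along sequences, the form in which dominated
    convergence applies. If the limit fails, points within [1 / (n + 1)] of [(x, y)] with values far
    from [Q x y] form a contradicting sequence. *)
Lemma cvg_prod_seq (Q : R -> R -> R) (x y : R) :
  (forall u v : R^nat, u n @[n --> \oo] --> x -> v n @[n --> \oo] --> y ->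
    Q (u n) (v n) @[n --> \oo] --> Q x y) ->
  Q z.1 z.2 @[z --> (x, y)] --> Q x y.
Proof.
move=> H; apply/cvgrPdist_lt => e e0; apply: contrapT => nH.
have bad (n : nat) : exists z : R * R, [/\ `|x - z.1| < n.+1%:R^-1,
    `|y - z.2| < n.+1%:R^-1 & ~ `|Q x y - Q z.1 z.2| < e].
  apply: contrapT => nex; apply: nH.
  suff: nbhs (x, y) [set z | `|Q x y - Q z.1 z.2| < e] by [].
  apply/nbhs_ballP; exists n.+1%:R^-1; first by rewrite /= invr_gt0.
  by move=> z [b1 b2]; apply: contrapT => nQ; apply: nex; exists z.
have [z zP] := choice bad.
have cv (w : R) (p : nat -> R) : (forall n, `|w - p n| < n.+1%:R^-1) ->
    p n @[n --> \oo] --> w.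
  move=> wp; apply/cvgrPdist_lt => d d0.
  near=> n; apply: (lt_trans (wp n)); near: n.
  have /cvgrPdist_lt /(_ d d0) := @cvg_harmonic R.
  by apply: filterS => n; rewrite sub0r normrN ger0_norm // invr_ge0.
have c1 := cv x (fst \o z) (fun n => let: And3 h _ _ := zP n in h).
have c2 := cv y (snd \o z) (fun n => let: And3 _ h _ := zP n in h).
have /cvgrPdist_lt /(_ e e0) [n _ /(_ n (leqnn n))] := H _ _ c1 c2.
by case: (zP n).
Unshelve. all: by end_near. Qed.

(** The increment is split through the intermediate point [(x s, y t)]. The part along the second
    coordinate is handled by the mean value theorem, so continuity is required of the second partial
    derivative [Q] only; the first one has to exist at one point. *)
Lemma is_derive_chain2 (Phi Q : R -> R -> R) (x y : R -> R) (t p x' y' : R) :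
  (forall u v : R, is_derive v 1 (Phi u) (Q u v)) ->
  is_derive (x t) 1 (Phi^~ (y t)) p ->
  Q z.1 z.2 @[z --> (x t, y t)] --> Q (x t) (y t) ->
  is_derive t 1 x x' -> is_derive t 1 y y' ->
  is_derive t 1 (fun s => Phi (x s) (y s)) (p * x' + Q (x t) (y t) * y').
Proof.
move=> dQ dp cQ dx dy.
have cx := is_derive_continuous dx.
have cy := is_derive_continuous dy.
(* The difference quotient in the second coordinate, completed by its expected limit so that [qE]
   also holds when [y s = y t]. *)
pose q s := if y s == y t then Q (x t) (y t)
  else (Phi (x s) (y s) - Phi (x s) (y t)) / (y s - y t).
have MVTQ u v w : exists2 c, `|w - c| <= `|w - v| & Phi u v - Phi u w = Q u c * (v - w).
  have cPhi a b : {within `[a, b], continuous Phi u}.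
    by apply: continuous_subspaceT => z; exact: is_derive_continuous (dQ u z).
  have [vw|wv] := leP v w.
    have [c] := MVT_segment vw (fun z _ => dQ u z) (cPhi _ _).
    rewrite in_itv /= => /andP[vc cw] E; exists c.
      by rewrite !ger0_norm ?subr_ge0 // lerB.
    by rewrite -opprB E -mulrN opprB.
  have [c] := MVT_segment (ltW wv) (fun z _ => dQ u z) (cPhi _ _).
  rewrite in_itv /= => /andP[wc cv] E; exists c => //.
  by rewrite !ler0_norm ?subr_le0 // ?(ltW wv) // lerN2 lerB.
have qE s : Phi (x s) (y s) - Phi (x s) (y t) = q s * (y s - y t).
  rewrite /q; case: eqP => [->|/eqP ne]; first by rewrite !subrr mulr0.
  by rewrite divfK // subr_eq0.
have cq : q s @[s --> t] --> Q (x t) (y t).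
  apply/cvgrPdist_lt => e e0.
  have /cvgrPdist_lt /(_ e e0) /nbhs_ballP [d /= d0 dP] := cQ.
  have /cvgrPdist_lt /(_ d d0) nx := cx.
  have /cvgrPdist_lt /(_ d d0) ny := cy.
  near=> s; rewrite /q; case: eqP => [_|/eqP ne]; first by rewrite subrr normr0.
  have [c cy' ->] := MVTQ (x s) (y s) (y t).
  rewrite mulfK ?subr_eq0 //; apply: (dP (x s, c)); split => /=.
    by near: s.
  by apply: (le_lt_trans cy'); near: s.
have -> : (fun s => Phi (x s) (y s)) =
    (fun s => Phi (x s) (y t)) + (fun s => q s * (y s - y t)).
  by apply/funext => s; rewrite /GRing.add /= -qE addrC subrK.
apply: is_deriveD.
  exact: (@is_derive1_comp _ (Phi^~ (y t)) x t _ _ dp dx).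
have /cvg_ex [l hl] : derivable y t 1 by exact: ex_derive.
have El : l = y'.
  have <- : 'D_1 y t = y' by exact: derive_val.
  by apply/esym/cvg_lim.
(* The second summand vanishes at [t], so its difference quotient is [q] times that of [y]; no
   derivative of [q] is involved. *)
have H : h^-1 *: (q (h *: 1 + t) * (y (h *: 1 + t) - y t) - q t * (y t - y t)) @[h --> 0^'] -->
    Q (x t) (y t) * y'.
  under eq_fun do rewrite subrr mulr0 subr0 scalerAr.
  apply: cvgM; last by rewrite -El.
  have c0 : h *: (1 : R) + t @[h --> (0 : R)^'] --> t.
    apply: cvg_within_filter.
    suff: h *: (1 : R) + t @[h --> (0 : R)] --> (0 : R) *: (1 : R) + t by rewrite scale0r add0r.
    by apply: cvgD; [apply: cvgZ; [exact: cvg_id|exact: cvg_cst]|exact: cvg_cst].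
  exact: (cvg_comp _ _ c0 cq).
apply: DeriveDef; first by apply/cvg_ex; exists (Q (x t) (y t) * y').
by rewrite /derive; apply/cvg_lim.
Unshelve. all: by end_near. Qed.

End calculus.

(** * Potentials of the kernel *)

Section potential.
Context {R : realType}.
Let mu := @lebesgue_measure R.
Variables (L : R) (f g : R -> R).
Hypotheses (L0 : 0 < L) (cf : continuous f) (cg : continuous g).
Let I := `[- L, L] : set R.

Let mI : measurable I. Proof. exact: measurable_itv. Qed.

Let LL : - L < L. Proof. by move: L0; lra. Qed.

Let muI : (mu I < +oo)%E.
Proof. by rewrite /mu /I lebesgue_measure_itv /= lte_fin LL -EFinB ltry. Qed.

Let cts (h : R -> R) : continuous h -> {within I, continuous h}.
Proof. by move=> ch; exact: continuous_subspaceT. Qed.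

Let mf : measurable_fun setT f. Proof. exact: continuous_measurable_fun. Qed.
Let mg : measurable_fun setT g. Proof. exact: continuous_measurable_fun. Qed.

Definition kerint (s x y : R) : R :=
  \int[mu]_(t in I) (f s * g t * ker (x - s) (y - t)).

Definition kerpot (x y : R) : R := \int[mu]_(s in I) kerint s x y.

Definition atanint (s x y : R) : R :=
  \int[mu]_(t in I) (f s * g t * atan ((y - t) / (x - s))).

Definition atanpot (x y : R) : R := \int[mu]_(s in I) atanint s x y.

Let IP t : I t -> - L <= t <= L. Proof. by rewrite /I /= in_itv. Qed.

Lemma fg_bound : exists2 M, 0 <= M &
  forall s t, I s -> I t -> `|f s * g t| <= M.
Proof.
have [M1 M10 fM] := continuous_itv_bound (cts cf).
have [M2 M20 gM] := continuous_itv_bound (cts cg).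
exists (M1 * M2); first exact: mulr_ge0.
by move=> s t /IP Is /IP It; rewrite normrM ler_pM // ?fM ?gM.
Qed.

Lemma kerint_continuous s x y : continuous (fun t => f s * g t * ker (x - s) (y - t)).
Proof.
move=> t; apply: cvgM; last exact: ker_continuous.
by apply: cvgM; [exact: cvg_cst|exact: cg].
Qed.

Lemma atanint_continuous s x y :
  continuous (fun t => f s * g t * atan ((y - t) / (x - s))).
Proof.
move=> t; apply: cvgM; first by apply: cvgM; [exact: cvg_cst|exact: cg].
apply: (@cvg_comp _ _ _ (fun t => (y - t) / (x - s)) atan); last exact: continuous_atan.
by apply: cvgM; [apply: cvgB; [exact: cvg_cst|exact: cvg_id]|exact: cvg_cst].
Qed.

Lemma kerint_le M s x y : 0 <= M -> (forall t, I t -> `|f s * g t| <= M) ->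
  (\int[mu]_(t in I) `|f s * g t * ker (x - s) (y - t)|%:E <= (M * pi)%:E)%E.
Proof.
move=> M0 fgM.
have mk : measurable_fun I (fun t => `|ker (x - s) (y - t)|).
  apply: measurable_funTS; apply: measurableT_comp => //.
  by apply: measurable_ker => //; exact: measurable_funB.
apply: (@le_trans _ _ (\int[mu]_(t in I) (M%:E * `|ker (x - s) (y - t)|%:E))%E).
  apply: ge0_le_integral => //.
  - apply/measurable_EFinP; apply: measurableT_comp => //.
    by apply: measurable_funTS; apply: continuous_measurable_fun; exact: kerint_continuous.
  - by apply/measurable_EFinP; exact: measurable_funM.
  - by move=> t It; rewrite -EFinM lee_fin normrM ler_wpM2r // fgM.
rewrite ge0_integralZl //; last exact/measurable_EFinP.
by rewrite EFinM lee_wpmul2l ?lee_fin // integral_ker_le.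
Qed.

Lemma kerint_norm_le M s x y : 0 <= M -> (forall t, I t -> `|f s * g t| <= M) ->
  `|kerint s x y| <= M * pi.
Proof.
move=> M0 fgM.
have ik : mu.-integrable I (EFin \o (fun t => f s * g t * ker (x - s) (y - t))).
  by apply: continuous_integrable_itv; apply: cts; exact: kerint_continuous.
rewrite -lee_fin EFin_normr_Rintegral //.
apply: le_trans (kerint_le x y M0 fgM).
by apply: le_abse_integral => //; exact: measurable_int ik.
Qed.

Lemma integrable_kerint2 x y : (mu \x mu)%E.-integrable (I `*` I)
  (EFin \o (fun p => f p.1 * g p.2 * ker (x - p.1) (y - p.2))).
Proof.
have [M M0 fgM] := fg_bound.
apply: (@integrable_setX1 _ _ _ _ _ mu mu I I mI mI _ (M * pi)) => //.
- apply: measurable_funM.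
    by apply: measurable_funM; exact: measurableT_comp.
  by apply: measurable_ker; apply: measurable_funB.
- by rewrite mulr_ge0 // pi_ge0.
- by move=> s Is; apply: kerint_le => // t It; exact: fgM.
Qed.

Lemma integrable_atanint2 x y : (mu \x mu)%E.-integrable (I `*` I)
  (EFin \o (fun p => f p.1 * g p.2 * atan ((y - p.2) / (x - p.1)))).
Proof.
have [M M0 fgM] := fg_bound.
apply: measurable_bounded_integrable.
- exact: measurableX.
- have E : (mu \x mu)%E (I `*` I) = (mu I * mu I)%E by exact: product_measure1E.
  by apply: (@le_lt_trans _ _ (mu I * mu I)%E); [rewrite -E|rewrite lte_mul_pinfty // ge0_fin_numE].
- apply: measurable_funTS; apply: measurable_funM.
    by apply: measurable_funM; exact: measurableT_comp.
  by apply: measurable_atan_div; apply: measurable_funB.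
exists (M * pi); split; first exact: num_real.
move=> N MN [s t] [/= Is It]; apply: le_trans (ltW MN).
rewrite normrM ler_pM // ?fgM //.
by have := atanB_le ((y - t) / (x - s)) 0; rewrite atan0 subr0.
Qed.

Lemma is_derive_atanint (s x y : R) : I s ->
  is_derive y 1 (atanint s x) (kerint s x y).
Proof.
move=> Is; have [M M0 fgM] := fg_bound.
(* For a fixed [s] the kernel is bounded by [|x - s|^-1]. For [s = x] this bound is 0, and so is the
   kernel. *)
apply: (@is_derive_Rintegral _ _ _ mu I
  (fun y t => f s * g t * atan ((y - t) / (x - s)))
  (fun y t => f s * g t * ker (x - s) (y - t)) (M * `|x - s|^-1)) => //.
- by rewrite mulr_ge0.
- by move=> z; apply: continuous_integrable_itv; apply: cts; exact: atanint_continuous.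
- move=> z t It.
  have d1 : is_derive z 1 (fun z : R => z - t) 1.
    by have := is_deriveB (is_derive_id z (1 : R)) (is_derive_cst t z 1); rewrite subr0.
  have := is_deriveZ (f s * g t) (@is_derive1_comp _ (fun v => atan (v / (x - s)))
    (fun z => z - t) z _ _ (is_derive_atan_div (x - s) (z - t)) d1).
  by rewrite mulr1.
- by move=> z t It; rewrite normrM ler_pM // ?fgM ?ker_le.
Qed.

(** Differentiation proceeds in two stages because the kernel is unbounded on the box: the inner
    stage uses a bound depending on [s], the outer one the uniform bound [M * pi] on the inner
    integral. *)
Lemma is_derive_atanpot (x y : R) : is_derive y 1 (atanpot x) (kerpot x y).
Proof.
have [M M0 fgM] := fg_bound.
apply: (@is_derive_Rintegral _ _ _ mu I (fun y s => atanint s x y)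
  (fun y s => kerint s x y) (M * pi)) => //.
- by rewrite mulr_ge0 // pi_ge0.
- by move=> z; exact: (@integrable_Rfubini1 _ _ _ _ _ mu mu I I mI mI _ (integrable_atanint2 x z)).
- by move=> z s Is; exact: is_derive_atanint.
- by move=> z s Is; apply: kerint_norm_le => // t It; exact: fgM.
Qed.

(* The inner integral is bounded uniformly in [s] (it is at most [M * pi]), and for
   [s != x] its integrand is bounded, so dominated convergence applies twice. *)
Lemma kerpot_cvg (x y : R) : kerpot z.1 z.2 @[z --> (x, y)] --> kerpot x y.
Proof.
have [M M0 fgM] := fg_bound.
apply: cvg_prod_seq => u v ux vy.
have mk a b : measurable_fun I (fun s => kerint s a b).
  apply/measurable_EFinP; apply: (measurable_int mu).
  exact: (@integrable_Rfubini1 _ _ _ _ _ mu mu I I mI mI _ (integrable_kerint2 a b)).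
apply: (@Rintegral_cvg _ _ _ mu I (fun n s => kerint s (u n) (v n)) _ (M * pi)) => //.
- by move=> n; exact: mk.
- exact: mk.
- exists [set x]; split; [exact: measurable_set1|exact: lebesgue_measure_set1|].
  move=> s /=; apply: contra_notP => /eqP sx Is.
  have xs0 : x - s != 0 by rewrite subr_eq0 eq_sym.
  have us : u n - s @[n --> \oo] --> x - s by apply: cvgB => //; exact: cvg_cst.
  have iv : (u n - s)^-1 @[n --> \oo] --> (x - s)^-1 by exact: cvgV.
  have [N [_ NP]] : bounded_fun (fun n => (u n - s)^-1)
    by apply: cvg_seq_bounded; apply/cvg_ex; exists (x - s)^-1.
  have Nb n : `|u n - s|^-1 <= `|N| + 1.
    rewrite -normfV; apply: (NP (`|N| + 1)) => //.
    by rewrite (le_lt_trans (ler_norm _)) // ltrDl.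
  have mq a b : measurable_fun I (fun t => f s * g t * ker (a - s) (b - t)).
    by apply: measurable_funTS; apply: continuous_measurable_fun; exact: kerint_continuous.
  apply: (@Rintegral_cvg _ _ _ mu I (fun n t => f s * g t * ker (u n - s) (v n - t)) _
    (M * (`|N| + 1))) => //.
  - by move=> n; exact: mq.
  - exact: mq.
  - apply: aeW => t It; apply: cvgM; first exact: cvg_cst.
    by apply: ker_cvg => //; apply: cvgB => //; exact: cvg_cst.
  - move=> n t It; rewrite normrM ler_pM // ?fgM //.
    exact: le_trans (ker_le _ _) (Nb n).
- by move=> n s Is; apply: kerint_norm_le => // t It; exact: fgM.
Qed.

End potential.

(** * Exchange of the coordinates and the exact form *)

Section swap.
Context {R : realType}.
Let mu := @lebesgue_measure R.

(** The number [pi / 2 - atan w] lies in the range of [atan] and its tangent is [w^-1]. *)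
Lemma atanV (w : R) : 0 < w -> atan w^-1 = pi / 2 - atan w.
Proof.
move=> w0; have a0 : 0 < atan w by rewrite -atan0 lt_atan.
have a1 := atan_ltpi2 w; have p0 := pi_gt0 R.
have <- : tan (pi / 2 - atan w) = w^-1.
  rewrite /tan -[in RHS](atanK w) /tan invf_div.
  have -> : pi / 2 - atan w = - (atan w - pi / 2) by ring.
  by rewrite sinN sinBpihalf cosN cosBpihalf opprK.
by rewrite tanK // in_itv /=; apply/andP; split; lra.
Qed.

(* No side condition: when [u = 0] or [v = 0], division by zero makes both sides 0. *)
Lemma atan_divD (u v : R) :
  atan (v / u) + atan (u / v) = pi / 2 * (Num.sg u * Num.sg v).
Proof.
have [->|u0] := eqVneq u 0; first by rewrite sgr0 invr0 !(mul0r, mulr0) atan0 addr0.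
have [->|v0] := eqVneq v 0; first by rewrite sgr0 invr0 !(mul0r, mulr0) atan0 addr0.
have -> : u / v = (v / u)^-1 by rewrite invf_div.
have -> : Num.sg u * Num.sg v = Num.sg (v / u).
  by rewrite sgrM sgrV mulrC.
have w0 : v / u != 0 by rewrite mulf_neq0 // invr_neq0.
move: (v / u) w0 => w; rewrite neq_lt => /orP[w0|w0].
  have := @atanV (- w); rewrite oppr_gt0 invrN !atanN ltr0_sg // => /(_ w0) E.
  by rewrite -[atan w^-1]opprK E; ring.
by rewrite atanV // gtr0_sg //; ring.
Qed.

Lemma measurable_sg d (T : measurableType d) (h : T -> R) :
  measurable_fun setT h -> measurable_fun setT (fun t => Num.sg (h t)).
Proof.
move=> mh.
have -> : (fun t => Num.sg (h t)) =
    (fun t => if h t == 0 then 0 else if h t < 0 then -1 else 1).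
  apply/funext => t; case: (ltgtP (h t) 0) => [h0|h0|->]; last exact: sgr0.
    exact: ltr0_sg.
  exact: gtr0_sg.
apply: measurable_fun_ifT; [exact: measurable_fun_eqr|exact: measurable_cst|].
by apply: measurable_fun_ifT => //; exact: measurable_fun_ltr.
Qed.

Lemma sg_bound (x : R) : `|Num.sg x| <= 1.
Proof. by rewrite normr_sg; case: (x != 0); rewrite ?lexx ?ler01. Qed.

Variable L : R.
Hypothesis L0 : 0 < L.
Let I := `[- L, L] : set R.

Let mI : measurable I. Proof. exact: measurable_itv. Qed.

Let muI : (mu I < +oo)%E.
Proof.
rewrite /mu /I lebesgue_measure_itv /= lte_fin ifT ?ltry //.
by move: L0; lra.
Qed.

Lemma bounded_integrable_itv (h : R -> R) C : measurable_fun setT h ->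
  (forall t, I t -> `|h t| <= C) -> mu.-integrable I (EFin \o h).
Proof.
move=> mh hC; apply: measurable_bounded_integrable => //.
- exact: measurable_funTS.
by exists C; split; [exact: num_real|move=> N CN t It; apply: le_trans (hC _ It) (ltW CN)].
Qed.

Section sgint.
Variables (f F : R -> R).
Hypotheses (cf : continuous f) (dF : forall t : R, is_derive t 1 F (f t)).

Let mf : measurable_fun setT f. Proof. exact: continuous_measurable_fun. Qed.

Lemma sg_integrable x : mu.-integrable I (EFin \o (fun s => f s * Num.sg (x - s))).
Proof.
have [M M0 fM] := @continuous_itv_bound _ f (- L) L (continuous_subspaceT cf).
apply: (@bounded_integrable_itv _ M).
  by apply: measurable_funM => //; apply: measurable_sg; exact: measurable_funB.
move=> t; rewrite /I /= in_itv /= => It; rewrite normrM -[leRHS]mulr1.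
by rewrite ler_pM // ?fM ?sg_bound.
Qed.

(** Cutting at [s = x], where the sign jumps, gives [F x - F (- L)] from the left and [F x - F L]
    from the right; the value at the single point [x] is irrelevant. *)
Lemma integral_sg x : - L < x < L ->
  \int[mu]_(s in I) (f s * Num.sg (x - s)) = 2 * F x - (F L + F (- L)).
Proof.
move=> /andP[Lx xL]; have ih := sg_integrable x.
have mh : measurable_fun setT (fun s => f s * Num.sg (x - s)).
  by apply: measurable_funM => //; apply: measurable_sg; exact: measurable_funB.
have /eqP := Rintegral_itvB ih (x := x) (ltW Lx) (ltW xL).
have ix : mu.-integrable `]x, L] (EFin \o (fun s => f s * Num.sg (x - s))).
  apply: integrableS ih => //; rewrite /I => s /=; rewrite !in_itv /= => /andP[xs sL].
  by apply/andP; split; lra.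
rewrite (Rintegral_itv_obnd_cbnd ix) subr_eq => /eqP ->.
have -> : \int[mu]_(s in `[x, L]) (f s * Num.sg (x - s)) = - F L - (- F x).
  rewrite /Rintegral (@eq_integral_itv_bounded _ _ _ (fun s => - f s)); last first.
  - move=> s; rewrite in_itv /= => /andP[xs _].
    by rewrite ltr0_sg ?subr_lt0 // mulrN1.
  - by apply: measurable_funTS; exact: measurableT_comp.
  - exact: measurable_funTS.
  have dN t : x <= t <= L -> is_derive t 1 (fun s => - F s) (- f t).
    by move=> _; exact: is_deriveN.
  rewrite (FTC2_is_derive xL dN) //.
  by apply: continuous_subspaceT => t; apply: cvgN; exact: cf.
have -> : \int[mu]_(s in `[- L, x]) (f s * Num.sg (x - s)) = F x - F (- L).
  rewrite /Rintegral (@eq_integral_itv_bounded _ _ _ f); last first.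
  - move=> s; rewrite in_itv /= => /andP[_ sx].
    by rewrite gtr0_sg ?subr_gt0 // mulr1.
  - exact: measurable_funTS.
  - exact: measurable_funTS.
  by rewrite (FTC2_is_derive Lx (fun t _ => dF t)) //; exact: continuous_subspaceT.
ring.
Qed.

End sgint.

Variables (f F g G : R -> R).
Hypotheses (cf : continuous f) (dF : forall t : R, is_derive t 1 F (f t)).
Hypotheses (cg : continuous g) (dG : forall t : R, is_derive t 1 G (g t)).

Let mf : measurable_fun setT f. Proof. exact: continuous_measurable_fun. Qed.
Let mg : measurable_fun setT g. Proof. exact: continuous_measurable_fun. Qed.

(** By [atan_divD] the two integrands add up to a function with separated variables, so the double
    integral becomes a product of two integrals evaluated by [integral_sg]. *)
Lemma atanpot_swap x y : - L < x < L -> - L < y < L ->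
  atanpot L f g x y + atanpot L g f y x =
  pi / 2 * (2 * F x - (F L + F (- L))) * (2 * G y - (G L + G (- L))).
Proof.
move=> xL yL; have [M M0 fgM] := fg_bound L cf cg.
have i1 := integrable_atanint2 L0 cf cg x y.
have i2 := integrable_atanint2 L0 cg cf y x.
(* Fubini brings the second potential to the order of integration of the first. *)
have -> : atanpot L g f y x =
    \int[mu]_(s in I) \int[mu]_(t in I) (g t * f s * atan ((x - s) / (y - t))).
  transitivity (\int[(mu \x mu)%E]_(z in I `*` I)
      (g z.1 * f z.2 * atan ((x - z.2) / (y - z.1)))).
    exact: (@Rfubini1 _ _ _ _ _ mu mu I I mI mI _ i2).
  by rewrite -(@Rfubini2 _ _ _ _ _ mu mu I I mI mI _ i2).
rewrite /atanpot -RintegralD //; last 2 first.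
- exact: (@integrable_Rfubini1 _ _ _ _ _ mu mu I I mI mI _ i1).
- exact: (@integrable_Rfubini2 _ _ _ _ _ mu mu I I mI mI _ i2).
transitivity (\int[mu]_(s in I) (f s * Num.sg (x - s) *
    (pi / 2 * (2 * G y - (G L + G (- L)))))); last first.
  rewrite RintegralZr //; last exact: sg_integrable.
  by rewrite (integral_sg cf dF xL); ring.
apply: eq_Rintegral => s /[!inE] Is.
rewrite /atanint -RintegralD //; last 2 first.
- by apply: continuous_integrable_itv; apply: continuous_subspaceT; exact: atanint_continuous.
- apply: (@bounded_integrable_itv _ (M * pi)).
    apply: measurable_funM; first exact: measurable_funM.
    by apply: measurable_atan_div => //; exact: measurable_funB.
  move=> t It; rewrite normrM ler_pM //; first by rewrite mulrC fgM.
  by have := atanB_le ((x - s) / (y - t)) 0; rewrite atan0 subr0.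
transitivity (\int[mu]_(t in I) ((f s * Num.sg (x - s) * (pi / 2)) *
    (g t * Num.sg (y - t)))).
  apply: eq_Rintegral => t _; rewrite (mulrC (g t)) -mulrDr atan_divD; ring.
rewrite RintegralZl //; last exact: sg_integrable.
by rewrite (integral_sg cg dG yL) !mulrA.
Qed.

(* Chosen so that [d greenpot] is [kerpot L f g x y dy - kerpot L g f y x dx]
   minus [2 pi F(x) g(y) dy]. *)
Definition greenpot (x y : R) : R :=
  atanpot L f g x y - pi * F x * (2 * G y - (G L + G (- L))).

Lemma is_derive_greenpot2 (x y : R) :
  is_derive y 1 (greenpot x) (kerpot L f g x y - 2 * pi * F x * g y).
Proof.
have d0 : is_derive y 1 (fun y => 2 * G y - (G L + G (- L))) (2 * g y).
  by have := is_deriveB (is_deriveZ (2 : R) (dG y)) (is_derive_cst (G L + G (- L)) y 1);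
    rewrite subr0.
have := is_deriveB (is_derive_atanpot L0 cf cg x y) (is_deriveZ (pi * F x) d0).
by congr (is_derive _ _ _ _); rewrite /GRing.scale /=; ring.
Qed.

(** By [atanpot_swap] the terms in [F x] cancel, and near [x] the function is [- atanpot L g f y]
    plus a constant. A derivative in the first variable thus becomes one in the second variable of
    the exchanged potential. *)
Lemma is_derive_greenpot1 (x y : R) : - L < x < L -> - L < y < L ->
  is_derive x 1 (greenpot^~ y) (- kerpot L g f y x).
Proof.
move=> xL yL; set c := 2 * G y - (G L + G (- L)).
pose k x := - atanpot L g f y x - (pi / 2 * (F L + F (- L)) * c).
have dk : is_derive x 1 k (- kerpot L g f y x).
  have := is_deriveB (is_deriveN (is_derive_atanpot L0 cg cf y x))
    (is_derive_cst (pi / 2 * (F L + F (- L)) * c) x 1).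
  by rewrite subr0.
apply: (near_eq_is_derive _ dk).
move: (xL) => /andP[xL1 xL2].
near=> z; rewrite /k /greenpot -/c.
have zL : - L < z < L.
  by apply/andP; split; near: z; [exact: lt_nbhsr|exact: lt_nbhsl].
have /eqP := atanpot_swap zL yL; rewrite -/c eq_sym -subr_eq => /eqP <-.
by field.
Unshelve. all: by end_near. Qed.

End swap.

(** * Fubini for the winding number *)

Section kernel_prod.
Context {R : realType}.
Let mu := @lebesgue_measure R.
Variables (L : R) (f g : R -> R).
Hypotheses (L0 : 0 < L) (cf : continuous f) (cg : continuous g).
Let I := `[- L, L] : set R.

Let mI : measurable I. Proof. exact: measurable_itv. Qed.

Let mf : measurable_fun setT f. Proof. exact: continuous_measurable_fun. Qed.
Let mg : measurable_fun setT g. Proof. exact: continuous_measurable_fun. Qed.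

Let muIE : mu I = (2 * L)%:E.
Proof.
rewrite /mu /I lebesgue_measure_itv /= lte_fin ifT; last by move: L0; lra.
by rewrite -EFinB; congr EFin; ring.
Qed.

Lemma measurable_kernel1 d (T : measurableType d) (u v a b : T -> R) :
  measurable_fun setT u -> measurable_fun setT v ->
  measurable_fun setT a -> measurable_fun setT b ->
  measurable_fun setT (fun w => f (a w) * g (b w) * ker (u w - a w) (v w - b w)).
Proof.
move=> mu_ mv ma mb; apply: measurable_funM.
  by apply: measurable_funM; exact: measurableT_comp.
by apply: measurable_ker; exact: measurable_funB.
Qed.

Lemma measurable_kernel2 d (T : measurableType d) (u v a b : T -> R) :
  measurable_fun setT u -> measurable_fun setT v ->
  measurable_fun setT a -> measurable_fun setT b ->
  measurable_fun setT (fun w => f (a w) * g (b w) * ker (v w - b w) (u w - a w)).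
Proof.
move=> mu_ mv ma mb; apply: measurable_funM.
  by apply: measurable_funM; exact: measurableT_comp.
by apply: measurable_ker; exact: measurable_funB.
Qed.

(** The bound is uniform in the singular point [(x, y)], so that this point can then move along a
    curve. *)
Lemma kernel1_bound : exists2 C, 0 <= C & forall x y,
  (\int[(mu \x mu)%E]_(z in I `*` I)
    `|f z.1 * g z.2 * ker (x - z.1) (y - z.2)|%:E <= C%:E)%E.
Proof.
have [M M0 fgM] := fg_bound L cf cg.
exists (M * pi * (2 * L)); first by rewrite !mulr_ge0 ?pi_ge0 // ltW.
move=> x y; rewrite EFinM -muIE.
apply: (@integral_setX1_le _ _ _ _ _ mu mu I I mI mI) => //.
- apply/measurable_EFinP; apply: measurableT_comp => //.
  exact: measurable_kernel1.
- by rewrite mulr_ge0 ?pi_ge0.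
- by move=> s Is; apply: kerint_le => // t It; exact: fgM.
Qed.

Let gfM M : (forall s t, I s -> I t -> `|f s * g t| <= M) ->
  forall t s, I t -> I s -> `|g t * f s| <= M.
Proof. by move=> fgM t s It Is; rewrite mulrC fgM. Qed.

(** Here the sections along the first coordinate are the ones with bounded integral, so Tonelli is
    used in the other order. *)
Lemma kernel2_bound : exists2 C, 0 <= C & forall x y,
  (\int[(mu \x mu)%E]_(z in I `*` I)
    `|f z.1 * g z.2 * ker (y - z.2) (x - z.1)|%:E <= C%:E)%E.
Proof.
have [M M0 /gfM fgM] := fg_bound L cf cg.
exists (M * pi * (2 * L)); first by rewrite !mulr_ge0 ?pi_ge0 // ltW.
move=> x y; rewrite EFinM -muIE.
apply: (@integral_setX2_le _ _ _ _ _ mu mu I I mI mI) => //.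
- apply/measurable_EFinP; apply: measurableT_comp => //.
  exact: measurable_kernel2.
- by rewrite mulr_ge0 ?pi_ge0.
- move=> t It; under eq_integral do rewrite /= (mulrC (f _)).
  by apply: kerint_le => // s Is; exact: fgM.
Qed.

Lemma kernel2_integrable x y : (mu \x mu)%E.-integrable (I `*` I)
  (EFin \o (fun z => f z.1 * g z.2 * ker (y - z.2) (x - z.1))).
Proof.
have [C _ hC] := kernel2_bound.
apply/integrableP; split; last by apply: le_lt_trans (hC x y) _; exact: ltry.
by apply/measurable_EFinP; apply: measurable_funTS; exact: measurable_kernel2.
Qed.

Lemma kerpot_prod1 x y : \int[(mu \x mu)%E]_(z in I `*` I)
  (f z.1 * g z.2 * ker (x - z.1) (y - z.2)) = kerpot L f g x y.
Proof. by rewrite -(@Rfubini1 _ _ _ _ _ mu mu I I mI mI _ (integrable_kerint2 L0 cf cg x y)). Qed.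

Lemma kerpot_prod2 x y : \int[(mu \x mu)%E]_(z in I `*` I)
  (f z.1 * g z.2 * ker (y - z.2) (x - z.1)) = kerpot L g f y x.
Proof.
rewrite -(@Rfubini2 _ _ _ _ _ mu mu I I mI mI _ (kernel2_integrable x y)).
by apply: eq_Rintegral => t _; apply: eq_Rintegral => s _; rewrite /= (mulrC (f _)).
Qed.

Section curve.
Variables (a b : R) (x y x' y' : R -> R).
Hypotheses (ab : a < b).
Hypotheses (dx : forall t : R, is_derive t 1 x (x' t)) (cx' : continuous x').
Hypotheses (dy : forall t : R, is_derive t 1 y (y' t)) (cy' : continuous y').
Let nu := sfprod mu mu.
Let J := `[a, b] : set R.

Let mJ : measurable J. Proof. exact: measurable_itv. Qed.

Let muJ : (mu J < +oo)%E.
Proof. by rewrite /mu /J lebesgue_measure_itv /= lte_fin ab -EFinB ltry. Qed.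

Let mx : measurable_fun setT x.
Proof. by apply: continuous_measurable_fun => t; exact: is_derive_continuous (dx t). Qed.

Let my : measurable_fun setT y.
Proof. by apply: continuous_measurable_fun => t; exact: is_derive_continuous (dy t). Qed.

(* The integrand of the winding number around [z], times [f z.1 * g z.2]. *)
Definition wangle (z : R * R) (t : R) : R :=
  f z.1 * g z.2 * ker (x t - z.1) (y t - z.2) * y' t
  - f z.1 * g z.2 * ker (y t - z.2) (x t - z.1) * x' t.

(** With [N] bounding [w] on [[a, b]], every section over the curve parameter has integral at most
    [C * N], and the parameter interval has finite length. *)
Lemma scaled_integrable (k : R * (R * R) -> R) (w : R -> R) (C : R) : 0 <= C ->
  measurable_fun setT k -> continuous w ->
  (forall t, (\int[nu]_(z in I `*` I) `|k (t, z)|%:E <= C%:E)%E) ->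
  (mu \x nu)%E.-integrable (J `*` (I `*` I)) (EFin \o (fun p => k p * w p.1)).
Proof.
move=> C0 mk cw kC.
have [N N0 wN] := @continuous_itv_bound _ w a b (continuous_subspaceT cw).
have mw : measurable_fun setT w by exact: continuous_measurable_fun.
have mII : measurable (I `*` I) by exact: measurableX.
apply: (@integrable_setX1 _ _ _ _ _ mu nu J (I `*` I) mJ mII _ (C * N)) => //.
- by apply: measurable_funM => //; exact: measurableT_comp.
- exact: mulr_ge0.
move=> t Jt.
have mkt : measurable_fun (I `*` I) (fun z => `|k (t, z)|%:E).
  apply/measurable_EFinP; apply: measurable_funTS; apply: measurableT_comp => //.
  exact: measurable_fun_pair2 mk.
apply: (@le_trans _ _ (\int[nu]_(z in I `*` I) (`|w t|%:E * `|k (t, z)|%:E))%E).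
  by under eq_integral do rewrite /= normrM mulrC EFinM.
rewrite ge0_integralZl // muleC EFinM.
apply: lee_pmul => //; first exact: integral_ge0.
by rewrite lee_fin wN //; move: Jt; rewrite /J /= in_itv.
Qed.

Lemma wangle_integrable : (mu \x nu)%E.-integrable (J `*` (I `*` I))
  (EFin \o (fun p => wangle p.2 p.1)).
Proof.
have m1 h : measurable_fun setT h -> measurable_fun setT (fun p : R * (R * R) => h p.1 : R).
  by move=> mh; exact: measurableT_comp.
have m21 : measurable_fun setT (fun p : R * (R * R) => p.2.1) by exact: measurableT_comp.
have m22 : measurable_fun setT (fun p : R * (R * R) => p.2.2) by exact: measurableT_comp.
have [C1 C10 hC1] := kernel1_bound; have [C2 C20 hC2] := kernel2_bound.
have i1 := @scaled_integrable (fun p => f p.2.1 * g p.2.2 * ker (x p.1 - p.2.1) (y p.1 - p.2.2))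
  y' C1 C10 (measurable_kernel1 (m1 _ mx) (m1 _ my) m21 m22) cy' (fun t => hC1 (x t) (y t)).
have i2 := @scaled_integrable (fun p => f p.2.1 * g p.2.2 * ker (y p.1 - p.2.2) (x p.1 - p.2.1))
  x' C2 C20 (measurable_kernel2 (m1 _ mx) (m1 _ my) m21 m22) cx' (fun t => hC2 (x t) (y t)).
have mJII : measurable (J `*` (I `*` I)) by apply: measurableX => //; exact: measurableX.
have i12 := @integrableB _ _ R (sfprod mu nu) _ mJII _ _ i1 i2.
by apply: eq_integrable i12.
Qed.

(** With the curve parameter fixed, integrating over the box first turns the two terms of the
    winding integrand into the two exchanged potentials. *)
Lemma fubini_wangle :
  nu.-integrable (I `*` I) (fun z => (\int[mu]_(t in J) wangle z t)%:E) /\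
  \int[nu]_(z in I `*` I) \int[mu]_(t in J) wangle z t =
  \int[mu]_(t in J) (kerpot L f g (x t) (y t) * y' t - kerpot L g f (y t) (x t) * x' t).
Proof.
have mII : measurable (I `*` I) by exact: measurableX.
split.
  exact: (@integrable_Rfubini2 _ _ _ _ _ mu nu J (I `*` I) mJ mII _ wangle_integrable).
transitivity (\int[(mu \x nu)%E]_(p in J `*` (I `*` I)) wangle p.2 p.1).
  exact: (@Rfubini2 _ _ _ _ _ mu nu J (I `*` I) mJ mII _ wangle_integrable).
rewrite -(@Rfubini1 _ _ _ _ _ mu nu J (I `*` I) mJ mII _ wangle_integrable).
apply: eq_Rintegral => t _.
have k1 := integrable_kerint2 L0 cf cg (x t) (y t); have k2 := kernel2_integrable (x t) (y t).
rewrite /wangle RintegralB //; last 2 first.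
- have k1y := @integrableZr _ _ R nu _ mII (y' t) _ k1.
  by apply: eq_integrable k1y.
- have k2x := @integrableZr _ _ R nu _ mII (x' t) _ k2.
  by apply: eq_integrable k2x.
have -> := @RintegralZr _ _ R nu _ _ (y' t) mII k1.
have -> := @RintegralZr _ _ R nu _ _ (x' t) mII k2.
congr (_ * _ - _ * _); first exact: kerpot_prod1.
exact: kerpot_prod2.
Qed.

End curve.

End kernel_prod.

(** * Green's formula *)

Section green.
Context {R : realType}.
Let mu := @lebesgue_measure R.
Let nu := sfprod mu mu.

Lemma lipschitz_C1 (x x' : R -> R) (a b : R) :
  (forall t : R, is_derive t 1 x (x' t)) -> continuous x' ->
  exists2 C, 0 < C & forall s t, a <= s <= b -> a <= t <= b ->
    `|x s - x t| <= C * `|s - t|.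
Proof.
move=> dx cx'.
have [C C0 xC] := @continuous_itv_bound _ x' a b (continuous_subspaceT cx').
(* Adding 1 keeps the constant positive even if [x'] vanishes. *)
exists (C + 1); first by rewrite ltr_wpDl.
have cx c d : {within `[c, d], continuous x}.
  by apply: continuous_subspaceT => t; exact: is_derive_continuous (dx t).
have H s t : a <= s -> t <= b -> s <= t -> `|x s - x t| <= (C + 1) * `|s - t|.
  move=> as_ tb st; have [c] := MVT_segment st (fun z _ => dx z) (cx s t).
  rewrite in_itv /= => /andP[sc ct] E.
  rewrite distrC E normrM (distrC s); apply: ler_wpM2r => //.
  have := xC c; rewrite (le_trans as_ sc) (le_trans ct tb) => /(_ isT) /le_trans; apply.
  by rewrite lerDl.
move=> s t /andP[as_ sb] /andP[at_ tb]; have [st|/ltW ts] := leP s t; first exact: H.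
by rewrite (distrC (x s)) (distrC s); exact: H.
Qed.

(** The winding number is prescribed only off the boundary; a finite union of null sets does not
    affect the integral. *)
Lemma sum_Rintegral_ae d (T : measurableType d) (la : {measure set T -> \bar R})
    (D : set T) (m : nat) (W : 'I_m -> T -> R) (N : 'I_m -> set T) (h : T -> R) :
  measurable D -> (forall l, la.-integrable D (EFin \o W l)) ->
  measurable_fun D h -> (forall l, la.-negligible (N l)) ->
  (forall z, D z -> (forall l, ~ N l z) -> \sum_(l < m) W l z = h z) ->
  \sum_(l < m) \int[la]_(z in D) W l z = \int[la]_(z in D) h z.
Proof.
move=> mD iW mh N0 Wh.
have iS : la.-integrable D (fun z => \sum_(l < m) (W l z)%:E)%E.
  by apply: integrable_sum => // l _; exact: iW.
transitivity (fine (\int[la]_(z in D) (\sum_(l < m) (W l z)%:E))%E).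
  rewrite integral_sum // /Rintegral.
  rewrite sum_fine // => l _.
  by apply: integrable_fin_num => //; exact: iW.
congr fine; apply: ae_eq_integral => //.
- exact: measurable_int iS.
- exact/measurable_EFinP.
have : {ae la, forall z, forall l, ~ N l z}.
  apply: filter_forall => l; have := N0 l.
  by apply: negligibleS => z /= /contrapT.
by apply: filterS => z Nz Dz /=; rewrite sumEFin Wh.
Qed.

Variables (f F g H : R -> R).
Hypotheses (cf : continuous f) (dF : forall t : R, is_derive t 1 F (f t)).
Hypotheses (cg : continuous g) (dH : forall t : R, is_derive t 1 H (g t)).

Let mf : measurable_fun setT f. Proof. exact: continuous_measurable_fun. Qed.
Let mg : measurable_fun setT g. Proof. exact: continuous_measurable_fun. Qed.
Let cF : continuous F.
Proof. by move=> t; exact: is_derive_continuous (dF t). Qed.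

Section box.
Variable L : R.
Hypothesis L0 : 0 < L.
Let I := `[- L, L] : set R.
Let mI : measurable I. Proof. exact: measurable_itv. Qed.
Let mII : measurable (I `*` I). Proof. exact: measurableX. Qed.

Lemma density_integrable : nu.-integrable (I `*` I) (EFin \o (fun z => f z.1 * g z.2)).
Proof.
have [M M0 fgM] := fg_bound L cf cg.
apply: measurable_bounded_integrable => //.
- have E : (mu \x mu)%E (I `*` I) = (mu I * mu I)%E by exact: product_measure1E.
  apply: (@le_lt_trans _ _ (mu I * mu I)%E); first by rewrite -E.
  rewrite /mu /I lebesgue_measure_itv /= lte_fin ifT; last by move: L0; lra.
  by rewrite -EFinB -EFinM ltry.
- by apply: measurable_funTS; apply: measurable_funM; exact: measurableT_comp.
exists M; split; first exact: num_real.
by move=> N MN [s t] [/= Is It]; apply: le_trans (ltW MN); exact: fgM.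
Qed.

Section piece.
Variable c : piece R.
Hypotheses (C1c : C1_piece c).
Let a := ca c. Let b := cb c. Let x := cx c. Let y := cy c.
Let x' := derive1 x. Let y' := derive1 y.

Let ab : a < b. Proof. by have [] := C1c. Qed.
Let dx (t : R) : is_derive t 1 x (x' t).
Proof. by have [_ [dx _]] := C1c; apply: DeriveDef => //; rewrite /x' derive1E. Qed.
Let dy (t : R) : is_derive t 1 y (y' t).
Proof. by have [_ [_ [dy _]]] := C1c; apply: DeriveDef => //; rewrite /y' derive1E. Qed.
Let cx' : continuous x'. Proof. by have [_ [_ [_ []]]] := C1c. Qed.
Let cy' : continuous y'. Proof. by have [_ [_ [_ []]]] := C1c. Qed.
Let cx0 : continuous x.
Proof. by move=> t; exact: is_derive_continuous (dx t). Qed.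
Let cy0 : continuous y.
Proof. by move=> t; exact: is_derive_continuous (dy t). Qed.

Lemma negligible_piece : nu.-negligible
  [set z | exists2 t, a <= t <= b & z = (x t, y t)].
Proof.
have [C1 C10 lx] := lipschitz_C1 a b dx cx'.
have [C2 C20 ly] := lipschitz_C1 a b dy cy'.
apply: (@negligible_lipschitz_curve _ x y a b (C1 + C2)) => //.
- exact: addr_gt0.
- move=> s t st tt; apply: le_trans (lx s t st tt) _.
  by rewrite ler_wpM2r // lerDl ltW.
- move=> s t st tt; apply: le_trans (ly s t st tt) _.
  by rewrite ler_wpM2r // lerDr ltW.
Qed.

(** Off the piece the denominator does not vanish, so the quotient is continuous, hence integrable,
    and the factor depending on [z] alone comes out. *)
Lemma integral_wangle z : (forall t, a <= t <= b -> z <> (x t, y t)) ->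
  \int[mu]_(t in `[a, b]) wangle f g x y x' y' z t =
  f z.1 * g z.2 * \int[mu]_(t in `[a, b])
    (((x t - z.1) * y' t - (y t - z.2) * x' t)
      / ((x t - z.1) ^+ 2 + (y t - z.2) ^+ 2)).
Proof.
move=> zc; rewrite -RintegralZl //.
  apply: eq_Rintegral => t _; rewrite /wangle /ker.
  by rewrite [(y t - z.2) ^+ 2 + _]addrC; ring.
apply: continuous_integrable_itv.
apply: (@continuous_in_subspaceT _ _ `[a, b]) => t /[!inE] /= /[!in_itv] /= tab.
have cu : {for t, continuous (fun t => x t - z.1)} by apply: cvgB; [exact: cx0|exact: cvg_cst].
have cv : {for t, continuous (fun t => y t - z.2)} by apply: cvgB; [exact: cy0|exact: cvg_cst].
apply: cvgM.
  by apply: cvgB; apply: cvgM => //; [exact: cy'|exact: cx'].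
apply: cvgV; last by apply: cvgD; rewrite !expr2; under eq_fun do rewrite expr2; exact: cvgM.
apply/negP; rewrite paddr_eq0 ?sqr_ge0 // !sqrf_eq0 !subr_eq0 => /andP[/eqP xz /eqP yz].
by apply: (zc t tab); rewrite xz yz; case: (z).
Qed.

Hypothesis inbox : forall t, a <= t <= b -> - L < x t < L /\ - L < y t < L.

(** The fundamental theorem of calculus for [greenpot] along the piece. In the proof [Q] is the
    second partial derivative of [greenpot] and [psi] its derivative along the curve. *)
Lemma integral_kerpot_piece :
  \int[mu]_(t in `[a, b])
    (kerpot L f g (x t) (y t) * y' t - kerpot L g f (y t) (x t) * x' t) =
  greenpot L f F g H (x b) (y b) - greenpot L f F g H (x a) (y a)
  + 2 * pi * \int[mu]_(t in `[a, b]) (F (x t) * g (y t) * y' t).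
Proof.
pose Q u v := kerpot L f g u v - 2 * pi * F u * g v.
pose psi t := - kerpot L g f (y t) (x t) * x' t + Q (x t) (y t) * y' t.
have cQ u v : Q z.1 z.2 @[z --> (u, v)] --> Q u v.
  apply: cvgB; first exact: kerpot_cvg.
  apply: cvgM; first apply: cvgM; first exact: cvg_cst.
    by apply: (@cvg_comp _ _ _ fst F _ (nbhs u)); [exact: cvg_fst|exact: cF].
  by apply: (@cvg_comp _ _ _ snd g _ (nbhs v)); [exact: cvg_snd|exact: cg].
have dpsi t : a <= t <= b ->
    is_derive t 1 (fun t => greenpot L f F g H (x t) (y t)) (psi t).
  move=> tab; have [xL yL] := inbox tab.
  apply: (@is_derive_chain2 _ (greenpot L f F g H) Q x y) => //.
  - by move=> u v; exact: is_derive_greenpot2.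
  - exact: is_derive_greenpot1.
have cFg : continuous (fun t => F (x t) * g (y t) * y' t).
  move=> t; apply: cvgM; last exact: cy'.
  apply: cvgM.
    by apply: (@cvg_comp _ _ _ x F _ (nbhs (x t))); [exact: cx0|exact: cF].
  by apply: (@cvg_comp _ _ _ y g _ (nbhs (y t))); [exact: cy0|exact: cg].
have cpsi : continuous psi.
  move=> t; apply: cvgD; apply: cvgM; [|exact: cx'| |exact: cy'].
    apply: cvgN.
    exact: (@continuous2_cvg _ _ _ _ (nbhs t) _ y x (kerpot L g f) (y t) (x t)
      (kerpot_cvg L0 cg cf (x := y t) (y := x t)) (@cy0 t) (@cx0 t)).
  exact: (@continuous2_cvg _ _ _ _ (nbhs t) _ x y Q (x t) (y t)
    (cQ (x t) (y t)) (@cx0 t) (@cy0 t)).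
have E := FTC2_is_derive ab dpsi (continuous_subspaceT cpsi).
have ipsi := continuous_integrable_itv
  (continuous_subspaceT cpsi : {within `[a, b], continuous psi}).
have iFg := continuous_integrable_itv
  (continuous_subspaceT cFg : {within `[a, b], continuous _}).
have <- : \int[mu]_(t in `[a, b]) psi t =
    greenpot L f F g H (x b) (y b) - greenpot L f F g H (x a) (y a) by rewrite /Rintegral E.
rewrite -RintegralZl // -RintegralD //.
  apply: eq_Rintegral => t _; rewrite /psi /Q; ring.
exact: (integrableZl _ _ iFg).
Qed.

End piece.

End box.

Lemma green (Om : set (R * R)) (m : nat) (G : 'I_m -> piece R) :
  ps_domain Om G ->
  nu.-integrable Om (EFin \o (fun z => f z.1 * g z.2)) /\
  bdry_int_nx G (fun x y => F x * g y) = \int[nu]_(z in Om) (f z.1 * g z.2).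
Proof.
case=> -[oOm [M OmM]] C1G pG clG wG.
have mOm : measurable Om by exact: open_measurable_plane.
(* Boundary points are within distance 1 of [Om], so their coordinates are below [M + 1] in absolute
   value, and the cycle stays inside the open box. *)
pose L : R := `|M| + 2.
have L0 : 0 < L by rewrite ltr_wpDl.
pose I : set R := `[- L, L]%classic.
have mI : measurable I by exact: measurable_itv.
have mII : measurable (I `*` I) by exact: measurableX.
have ML : M < L by rewrite (le_lt_trans (ler_norm M)) // ltrDl.
have OmI : Om `<=` I `*` I.
  move=> z /OmM [z1 z2]; split; rewrite /I /= in_itv /= -ler_norml.
    exact: le_trans z1 (ltW ML).
  exact: le_trans z2 (ltW ML).
have iII := density_integrable L0.
have iOm : nu.-integrable Om (EFin \o (fun z => f z.1 * g z.2)).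
  exact: (@integrableS _ _ R nu _ _ _ mII mOm OmI iII).
split=> //.
have inbox l t : ca (G l) <= t <= cb (G l) ->
    - L < cx (G l) t < L /\ - L < cy (G l) t < L.
  move=> tl; have : (closure Om `\` Om) (cx (G l) t, cy (G l) t).
    by rewrite clG; exists l, t.
  case=> /(_ (ball (cx (G l) t, cy (G l) t) 1)) cl _.
  have [|z [/OmM [z1 z2] [/= b1 b2]]] := cl; first exact: nbhsx_ballx.
  have M1 : M + 1 < L by rewrite /L; have := ler_norm M; lra.
  move: z1 z2 b1 b2; rewrite /ball /= !ler_norml !ltr_norml.
  move=> /andP[? ?] /andP[? ?] /andP[? ?] /andP[? ?].
  by split; apply/andP; split; lra.
pose W l z := \int[mu]_(t in `[ca (G l), cb (G l)])
  wangle f g (cx (G l)) (cy (G l)) (derive1 (cx (G l))) (derive1 (cy (G l))) z t.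
have dG (h : R -> R) : (forall t, derivable h t 1) ->
    forall t : R, is_derive t 1 h (derive1 h t).
  by move=> dh t; apply: DeriveDef => //; rewrite derive1E.
have FW l : nu.-integrable (I `*` I) (EFin \o W l) /\
    \int[nu]_(z in I `*` I) W l z =
    greenpot L f F g H (piece_end (G l)).1 (piece_end (G l)).2
    - greenpot L f F g H (piece_start (G l)).1 (piece_start (G l)).2
    + 2 * pi * \int[mu]_(t in `[ca (G l), cb (G l)])
        (F (cx (G l) t) * g (cy (G l) t) * derive1 (cy (G l)) t).
  have [ab [dx [dy [cx' cy']]]] := C1G l.
  have [iW EW] := fubini_wangle L0 cf cg ab (dG _ dx) cx' (dG _ dy) cy'.
  split; first exact: iW.
  rewrite -(integral_kerpot_piece L0 (C1G l)); last exact: inbox.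
  exact: EW.
(* The value off the cycle of the sum of the [W l]: the winding number is the indicator of [Om], and
   [2 * pi] undoes its normalization. *)
pose h := (fun z : R * R => 2 * pi * (f z.1 * g z.2)) \_ Om.
have mfg : measurable_fun setT (fun z : R * R => f z.1 * g z.2).
  by apply: measurable_funM; exact: measurableT_comp.
have := @sum_Rintegral_ae _ _ nu (I `*` I) m W
  (fun l => [set z | exists2 t, ca (G l) <= t <= cb (G l) & z = (cx (G l) t, cy (G l) t)])
  h mII (fun l => (FW l).1) _ (fun l => negligible_piece (C1G l)) _.
rewrite -Rintegral_mkcondr (setIidr OmI) RintegralZl // => E.
have : \sum_(l < m) \int[nu]_(z in I `*` I) W l z = 2 * pi * bdry_int_nx G (fun x y => F x * g y).
  under eq_bigr do rewrite (FW _).2.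
  rewrite big_split /= sumrB -mulr_sumr.
  (* The start points are a permutation of the end points, so the values of [greenpot] cancel over
     the closed cycle. *)
  have -> : \sum_(l < m) greenpot L f F g H (piece_end (G l)).1 (piece_end (G l)).2 =
      \sum_(l < m) greenpot L f F g H (piece_start (G l)).1 (piece_start (G l)).2.
    have B (u : 'I_m -> R * R) : \sum_(l < m) greenpot L f F g H (u l).1 (u l).2 =
        \sum_(z <- [seq u l | l <- enum 'I_m]) greenpot L f F g H z.1 z.2.
      by rewrite big_map big_enum.
    by rewrite !B; apply: perm_big; rewrite perm_sym.
  by rewrite subrr add0r.
rewrite E => [/esym E2||].
- by apply: mulfI E2; rewrite mulf_neq0 ?gt_eqF ?pi_gt0.
- apply: measurable_funTS; apply/(measurable_restrictT _ mOm).
  by apply: measurable_funTS; exact: measurable_funM.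
move=> z _ Nz.
have nz : ~ on_cycle G z by move=> [l [t tl zt]]; apply: (Nz l); exists t.
have := wG z nz; rewrite /winding => wz.
under eq_bigr => l _.
  rewrite /W (integral_wangle (C1G l)); last by move=> t tl zt; apply: (Nz l); exists t.
  over.
rewrite -mulr_sumr.
have pi2 : 2 * pi != 0 :> R by rewrite mulf_neq0 ?gt_eqF ?pi_gt0.
move: wz; set S := \sum_(l < m) _ => wz.
have -> : S = 2 * pi * (if `[< Om z >] then 1 else 0) by rewrite -wz mulVKf.
rewrite /h patchE; have [Oz|Oz] := pselect (Om z).
  by rewrite asboolT // mem_set //; ring.
by rewrite asboolF // memNset // !mulr0.
Qed.

End green.

(** * Exactness of the cubature rule *)

Section cubature.
Context {R : realType}.
Let nu := sfprod (@lebesgue_measure R) (@lebesgue_measure R).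

Lemma is_derive_pow (n : nat) (t : R) :
  is_derive t 1 (fun t => t ^+ n.+1) (n.+1%:R * t ^+ n).
Proof.
have -> : (fun t : R => t ^+ n.+1) = id ^+ n.+1 by apply/funext => s; rewrite exprfctE.
have := is_deriveX n.+1 (is_derive_id t (1 : R)).
by rewrite /GRing.scale /= mulr1.
Qed.

Lemma green_monomial (Om : set (R * R)) (m : nat) (G : 'I_m -> piece R) (a b : nat) :
  ps_domain Om G ->
  nu.-integrable Om (EFin \o (fun z => z.1 ^+ a * z.2 ^+ b)) /\
  bdry_int_nx G (fun x y => x ^+ a.+1 * y ^+ b) =
    a.+1%:R * \int[nu]_(z in Om) (z.1 ^+ a * z.2 ^+ b).
Proof.
move=> dom; have mOm : measurable Om by apply: open_measurable_plane; case: dom => -[].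
have cX n : continuous (fun t : R => t ^+ n) by exact: exprn_continuous.
have dP n (t : R) : is_derive t 1 (fun t => n.+1%:R^-1 * t ^+ n.+1) (t ^+ n).
  have := is_deriveZ (n.+1%:R^-1 : R) (is_derive_pow n t).
  by rewrite /GRing.scale /= mulKf // pnatr_eq0.
have [iab _] := green (cX a) (dP a) (cX b) (dP b) dom.
split; first exact: iab.
have caX : continuous (fun t : R => a.+1%:R * t ^+ a).
  by move=> t; apply: cvgM; [exact: cvg_cst|exact: cX].
have [_ ->] := green caX (is_derive_pow a) (cX b) (dP b) dom.
rewrite -(@RintegralZl _ _ R nu _ _ _ mOm iab).
by apply: eq_Rintegral => z _; rewrite mulrA.
Qed.

(** The product rule on values. The truncated predecessor of exponent 0 is harmless, since the
    coefficient in front of it is 0. *)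
Lemma derive_powM (i1 i2 : nat) (x : R) :
  i1%:R * x ^+ i1.-1 * x ^+ i2 + x ^+ i1 * (i2%:R * x ^+ i2.-1) =
  (i1 + i2)%:R * x ^+ (i1 + i2).-1.
Proof.
case: i1 => [|i1] /=; first by rewrite add0n expr0; ring.
case: i2 => [|i2] /=; first by rewrite !addn0 expr0; ring.
by rewrite natrD !exprS !exprD exprS; ring.
Qed.

(** The monomial [x ^ a.+1 * y ^ b] has degree at most [2 * p]. The first factor is filled up to
    degree [p], with powers of [x] before powers of [y], and the remainder has degree at most
    [p]. *)
Lemma split_degree (p a b : nat) : (a + b < 2 * p)%N ->
  exists i1 i2 k1 k2 : nat, [/\ (i1 + i2 = a.+1)%N, (k1 + k2 = b)%N,
    (i1 + k1 <= p)%N & (i2 + k2 <= p)%N].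
Proof.
move=> ab; exists (minn a.+1 p), (a.+1 - minn a.+1 p)%N,
  (minn b (p - minn a.+1 p)), (b - minn b (p - minn a.+1 p))%N.
by split; lia.
Qed.

Lemma diag_quad n (H : 'M[R]_n) (u v : 'cV[R]_n) : is_diag H ->
  (u^T *m H *m v) 0 0 = \sum_(j < n) H j j * (u j 0 * v j 0).
Proof.
move=> dH; rewrite mxE; apply: eq_bigr => j _.
rewrite mxE (bigD1 j) //= big1 ?addr0 ?mxE; last first.
  by move=> k kj; rewrite (dH k j kj) mulr0.
by ring.
Qed.

(** Positive definiteness tested on the unit vectors makes the diagonal entries positive.
    Invertibility is what recovers [Q] as [H *m D]. *)
Lemma diag_posdef_unitmx n (H : 'M[R]_n) : is_diag H ->
  (forall v : 'cV[R]_n, v != 0 -> 0 < (v^T *m H *m v) 0 0) -> H \in unitmx.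
Proof.
move=> dH pH; have -> : H = diag_mx (\row_j H j j).
  apply/matrixP => i j; rewrite !mxE; have [->|ij] := eqVneq i j; first by rewrite mulr1n.
  by rewrite mulr0n dH.
rewrite unitmxE det_diag unitfE; apply/prodf_neq0 => j _; rewrite mxE.
have dj0 : delta_mx j 0 != 0 :> 'cV[R]_n.
  by apply/eqP => /matrixP /(_ j 0); rewrite !mxE !eqxx => /eqP; rewrite oner_eq0.
have := pH _ dj0; rewrite diag_quad // (bigD1 j) //= big1 ?addr0; last first.
  by move=> k kj; rewrite mxE (negbTE kj) mul0r mulr0.
by rewrite mxE !eqxx !mulr1 => /gt_eqF ->.
Qed.

Lemma SBP_cubature_monomial (Om : set (R * R)) (m : nat) (G : 'I_m -> piece R)
    (n : nat) (sx sy : 'I_n -> R) (p : nat) (D H : 'M[R]_n) (a b : nat) :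
  ps_domain Om G -> SBP_x Om G sx sy p D H -> is_diag H -> (a + b < 2 * p)%N ->
  \sum_(j < n) H j j * (sx j ^+ a * sy j ^+ b) =
  \int[nu]_(z in Om) (z.1 ^+ a * z.2 ^+ b).
Proof.
move=> dom [Dp Hs Hp [Q [DQ [QA [E [tau [ptau QE QAa Es Ebd]]]]]]] dH ab.
have [i1 [i2 [k1 [k2 [ia kb ik1 ik2]]]]] := split_degree ab.
pose v1 := nodal sx sy (Pmono (i1 + k1) i1).
pose v2 := nodal sx sy (Pmono (i2 + k2) i2).
have D1 : D *m v1 = nodal sx sy (dPmono (i1 + k1) i1) by apply: Dp; split => //; exact: leq_addr.
have D2 : D *m v2 = nodal sx sy (dPmono (i2 + k2) i2) by apply: Dp; split => //; exact: leq_addr.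
have HD : H *m D = Q by rewrite DQ mulKVmx // diag_posdef_unitmx.
(* The antisymmetric part cancels, and the two halves of [E] add up. *)
have QQ : Q + Q^T = E.
  rewrite QE linearD linearZ /= QAa Es addrACA subrr add0r -scalerDl.
  by rewrite -[X in (X + _) *: _]div1r -[X in (_ + X) *: _]div1r -splitr scale1r.
(* Discrete integration by parts. *)
have key : v1^T *m E *m v2 = v1^T *m H *m (D *m v2) + (D *m v1)^T *m H *m v2.
  by rewrite -QQ mulmxDr mulmxDl -HD !trmx_mul Hs !mulmxA.
have b1 : in_basis tau (i1 + k1) i1 by split; [exact: leq_addr|exact: leq_trans ptau].
have b2 : in_basis tau (i2 + k2) i2 by split; [exact: leq_addr|exact: leq_trans ptau].
have a0 : a.+1%:R != 0 :> R by rewrite pnatr_eq0.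
(* The factor [a.+1] comes from differentiating [x ^ a.+1]; it is nonzero and is cancelled at the
   end of the argument in this way. *)
apply: (mulfI a0).
have [_ <-] := green_monomial a b dom.
have -> : (fun x y : R => x ^+ a.+1 * y ^+ b) =
    (fun x y => Pmono (i1 + k1) i1 x y * Pmono (i2 + k2) i2 x y).
  apply/funext => x; apply/funext => y.
  by rewrite /Pmono !addKn -ia -kb !exprD; ring.
have := Ebd _ _ _ _ b1 b2; rewrite -/v1 -/v2 key D1 D2.
move=> /matrixP /(_ 0 0); rewrite mxE !diag_quad // [RHS]mxE eqxx mulr1n => <-.
rewrite -big_split /= mulr_sumr; apply: eq_bigr => j _.
rewrite !mxE /Pmono /dPmono !addKn -mulrDr mulrCA; congr (_ * _).
(* At each node the two derivative terms combine by the product rule into the derivative of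
   [x ^ a.+1 * y ^ b]. *)
have := derive_powM i1 i2 (sx j); rewrite ia /= => E1.
by rewrite -kb exprD [LHS]mulrA -E1; ring.
Qed.

End cubature.

(** Both sides are linear in [c], which reduces the claim to monomials; the condition
    [a + b < 2 * p] encodes degree at most [2p - 1]. Splitting the extended-valued integral relies
    on the integrability of each monomial on [Om], supplied by [green_monomial]. *)
Theorem theorem3p2 (R : realType) (Om : set (R * R)) (m : nat)
    (G : 'I_m -> piece R) (n : nat) (sx sy : 'I_n -> R) (p : nat)
    (D H : 'M[R]_n) :
  ps_domain Om G ->
  SBP_x Om G sx sy p D H ->
  is_diag H ->
  forall c : nat -> nat -> R,
    (\sum_(j < n) H j j * poly2 (2 * p) c (sx j) (sy j))%:E
    = (\int[area_meas R]_(z in Om) (poly2 (2 * p) c z.1 z.2)%:E)%E.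
Proof.
move=> dom sbp dH c; set d := (2 * p)%N.
pose nu := sfprod (@lebesgue_measure R) (@lebesgue_measure R).
have mOm : measurable Om by apply: open_measurable_plane; case: dom => -[].
have imon a b : nu.-integrable Om (fun z => (c a b)%:E * (z.1 ^+ a * z.2 ^+ b)%:E)%E.
  have [iab _] := green_monomial a b dom.
  exact: (@integrableZl _ _ R nu _ mOm (c a b) _ iab).
have isum a : nu.-integrable Om (fun z =>
    \sum_(b < d | (a + b < d)%N) ((c a b)%:E * (z.1 ^+ a * z.2 ^+ b)%:E))%E.
  by apply: (@integrable_sum _ _ R nu _ mOm) => b _; exact: imon.
transitivity (\int[nu]_(z in Om) (\sum_(a < d) \sum_(b < d | (a + b < d)%N)
    ((c a b)%:E * (z.1 ^+ a * z.2 ^+ b)%:E)))%E; last first.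
  apply: eq_integral => z _; rewrite /poly2 -sumEFin; apply: eq_bigr => a _.
  rewrite -sumEFin; apply: eq_bigr => b _.
  by rewrite -EFinM mulrA.
rewrite (@integral_sum _ _ R nu _ mOm _ _ (fun a : 'I_d => isum a)).
transitivity (\sum_(a < d) \sum_(b < d | (a + b < d)%N)
    (c a b * \sum_(j < n) H j j * (sx j ^+ a * sy j ^+ b))%:E)%E.
  apply: esym; under eq_bigr do rewrite sumEFin.
  rewrite sumEFin; congr EFin; apply: esym; rewrite /poly2.
  under eq_bigr do rewrite mulr_sumr.
  rewrite exchange_big /=; apply: eq_bigr => a _.
  under eq_bigr do rewrite mulr_sumr.
  rewrite exchange_big /=; apply: eq_bigr => b _.
  by rewrite mulr_sumr; apply: eq_bigr => j _; ring.
apply: eq_bigr => a _.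
rewrite (@integral_sum _ _ R nu _ mOm _ _ (fun b : 'I_d => imon a b)).
apply: eq_bigr => b ab.
have [iab _] := green_monomial a b dom.
rewrite (@integralZl _ _ R nu _ mOm _ iab) (SBP_cubature_monomial dom sbp dH ab).
rewrite EFinM; congr (_ * _)%E.
by rewrite /Rintegral fineK //; exact: (@integrable_fin_num _ _ R nu _ mOm _ iab).
Qed.
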